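(* Let $R$ be the local ring of a smooth variety over an algebraically closed field of characteristic zero at a (not necessarily closed) point. If $\mathfrak a_\bullet=\{\mathfrak a_m\}_{m\in\mathbb N}$ is a graded sequence of nonzero ideals in $R$ and $\mathfrak b_\bullet$ is the corresponding sequence of asymptotic multiplier ideals, then $\operatorname{lc}(\mathfrak a_\bullet)=\operatorname{lc}(\mathfrak b_\bullet)$.
   Context: $\mathbb N$ includes $0$. A graded sequence satisfies $\mathfrak a_p\mathfrak a_q\subseteq\mathfrak a_{p+q}$ for all $p,q\in\mathbb N$. For a nonzero ideal $\mathfrak a$, a log resolution is a proper birational $f:X'\to X=\operatorname{Spec}R$ with $X'$ smooth and $f^{-1}(V(\mathfrak a))\cup\mathrm{Ex}(f)$ a simple normal crossings divisor. Write $f^{-1}(V(\mathfrak a))=\sum\alpha_iE_i$ and $K_{X'/X}=\sum\gamma_iE_i$. Then $\operatorname{lc}(\mathfrak a)=\inf_i(\gamma_i+1)/\alpha_i$ over $i$ with $\alpha_i>0$ (so $\operatorname{lc}(R)=\infty$), and for rational $\lambda>0$, $\mathcal I(\lambda\cdot\mathfrak a)=f_*\mathcal O_{X'}(K_{X'/X}-[\lambda f^{-1}(V(\mathfrak a))])$, with $[\cdot]$ the coefficientwise round-down; both are independent of $f$. The ideals $\mathcal I(\frac{\lambda}{p}\cdot\mathfrak a_p)$, $p\ge1$, have a unique maximal element $\mathcal I(\lambda\cdot\|\mathfrak a_\bullet\|)$, and $\mathfrak b_m=\mathcal I(m\cdot\|\mathfrak a_\bullet\|)$ for $m\ge1$.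 Define $\operatorname{lc}(\mathfrak a_\bullet)=\lim_{m\to\infty}m\operatorname{lc}(\mathfrak a_m)$ and $\operatorname{lc}(\mathfrak b_\bullet)=\lim_{m\to\infty}m\operatorname{lc}(\mathfrak b_m)$ (these limits exist). *)

(* Defs.v *)
From HB Require Import structures.
From mathcomp Require Import all_boot all_order all_algebra.
From mathcomp Require Import all_classical all_reals all_analysis.

Set Implicit Arguments.
Unset Strict Implicit.
Unset Printing Implicit Defensive.

Import Order.TTheory GRing.Theory Num.Theory.

Local Open Scope classical_set_scope.
Local Open Scope ring_scope.

(* All the schemes considered are integral, separated and birational to
   X = Spec R, so they have the same function field K.  They are encoded as
   models of K in the sense of Zariski (Zariski-Samuel, Commutative Algebra II,
   VI.17; EGA I, 8): a scheme is the set of its local rings, each of them being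
   a subring of K, and a point is identified with its local ring. *)

Section CommutativeAlgebra.
Variable K : fieldType.
Implicit Types (A B P I S V : set K).

Definition is_subring A : Prop := GRing.subring_closed (mem A).

Definition is_ideal A I : Prop :=
  [/\ I `<=` A, I 0, (forall x y, I x -> I y -> I (x + y))
    & forall c x, A c -> I x -> I (c * x)].

(* The ideal of A generated by X; meant for X `<=` A. *)
Definition ideal_gen A (X : set K) : set K := smallest (is_ideal A) X.

Definition is_prime_ideal A P : Prop :=
  [/\ is_ideal A P, ~ P 1 & forall x y, A x -> A y -> P (x * y) -> P x \/ P y].

Definition units A : set K := [set x | A x /\ exists2 y, A y & x * y = 1].

Definition nonunits A : set K := A `\` units A.

Definition is_local_ring A : Prop := is_subring A /\ is_ideal A (nonunits A).

Definition localization A P : set K :=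
  [set x | exists a s, [/\ A a, A s, ~ P s & x = a / s]].

(* Spec A, as the set of its local rings. *)
Definition Spec A : set (set K) :=
  [set S | exists2 P, is_prime_ideal A P & S = localization A P].

Definition has_fraction_field_K A : Prop :=
  forall x : K, exists a b, [/\ A a, A b, b != 0 & x = a / b].

Definition finite_type B A : Prop :=
  exists s : seq K, A = smallest is_subring (B `|` [set` s]).

Definition is_noetherian A : Prop :=
  forall I, is_ideal A I -> exists s : seq K, I = ideal_gen A [set` s].

Definition prime_chain A (d : nat) (Q : nat -> set K) : Prop :=
  (forall i, (i <= d)%N -> is_prime_ideal A (Q i)) /\
  (forall i, (i < d)%N -> Q i `<` Q i.+1).

Definition krull_dim A (d : nat) : Prop :=
  (exists Q, prime_chain A d Q) /\
  (forall e Q, prime_chain A e Q -> (e <= d)%N).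

Definition regular_parameters S (d : nat) (x : 'I_d -> K) : Prop :=
  krull_dim S d /\ nonunits S = ideal_gen S (range x).

Definition is_regular_local_ring S : Prop :=
  [/\ is_local_ring S, is_noetherian S
    & exists (d : nat) (x : 'I_d -> K), regular_parameters S x].

Definition is_valuation_ring V : Prop :=
  is_subring V /\ forall x, x != 0 -> V x \/ V x^-1.

Definition dominates V S : Prop := S `<=` V /\ nonunits S `<=` nonunits V.

(* Orders of a nonzero element of K and of a nonzero ideal along a discrete
   valuation ring V with uniformizer t. *)
Definition ord V (h : K) : int :=
  xget 0 [set e : int | exists t u : K,
    [/\ nonunits V = ideal_gen V [set t], units V u & h = u * t ^ e]].

Definition ord_ideal V (a : set K) : nat :=
  xget 0%N [set e : nat | exists t : K,
    nonunits V = ideal_gen V [set t] /\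
    ideal_gen V a = ideal_gen V [set t ^+ e]].

End CommutativeAlgebra.

Section BirationalGeometry.
Variables (k : closedFieldType) (K : fieldType) (iota : {rmorphism k -> K}).
Implicit Types (R A P S V a I : set K) (M : set (set K)).

(* Over an algebraically closed field, smoothness of a variety means that all
   its local rings are regular. The variety may be taken affine, as the local
   ring at a point only depends on an affine open neighbourhood. *)
Definition local_ring_of_smooth_variety R : Prop :=
  exists A P, [/\ finite_type (range iota) A, has_fraction_field_K A,
    Spec A `<=` @is_regular_local_ring K, is_prime_ideal A P
    & R = localization A P].

(* Uniqueness of the center of a valuation ring is separatedness, its existence
   is properness. *)
Definition proper_birational R M : Prop :=
  (exists (N : nat) (A : 'I_N -> set K),
     (forall i, finite_type R (A i)) /\ M = \bigcup_(i in setT) Spec (A i)) /\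
  (forall V, is_valuation_ring V -> R `<=` V ->
     exists! S, M S /\ dominates V S).

(* f^-1(V(a)) U Ex(f), as a set of points of X'; f is a local isomorphism at S
   if and only if S is also a local ring of X = Spec R. *)
Definition special_locus R a : set (set K) :=
  [set S | a `<=` nonunits S \/ ~ Spec R S].

(* Near each point S of X', for some regular system of parameters x, the set
   f^-1(V(a)) U Ex(f) is the zero locus of \prod_(i in J) x i and the scheme
   f^-1(V(a)) is the divisor of a monomial in these x i. Since the x i are
   in the (Zariski) local ring S itself, the crossings are simple. *)
Definition log_resolution R a M : Prop :=
  [/\ proper_birational R M, M `<=` @is_regular_local_ring K
    & forall S, M S ->
      exists (d : nat) (x : 'I_d -> K) (J : {set 'I_d}) (e : 'I_d -> nat),
      [/\ regular_parameters S x,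
          forall P, is_prime_ideal S P ->
            (special_locus R a (localization S P) <-> P (\prod_(i in J) x i))
        & ideal_gen S a = ideal_gen S [set \prod_(i in J) x i ^+ e i]]].

Definition prime_divisor M V : Prop := M V /\ krull_dim V 1.

Definition is_derivation (D : K -> K) : Prop :=
  [/\ forall x y, D (x + y) = D x + D y,
      forall x y, D (x * y) = x * D y + y * D x
    & forall c, D (iota c) = 0].

(* Der_k(A, A) for a domain A with fraction field K. *)
Definition derivation_of A (D : K -> K) : Prop :=
  is_derivation D /\ forall x, A x -> A (D x).

Definition derivation_basis A (n : nat) (D : 'I_n -> K -> K) : Prop :=
  (forall i, derivation_of A (D i)) /\
  (forall E, derivation_of A E -> exists! c : 'rV[K]_n,
     (forall i, A (c 0 i)) /\ forall x, E x = \sum_i c 0 i * D i x).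

(* The coefficient of K_{X'/X} along the prime divisor with local ring V:
   K_{X'/X} is the divisor of the determinant of df : T_X' -> f^* T_X. *)
Definition rel_canonical_coef R V : int :=
  xget 0 [set g : int | exists (n : nat) (Delta D : 'I_n -> K -> K)
      (C : 'M[K]_n),
    [/\ derivation_basis R Delta, derivation_basis V D,
        (forall i x, D i x = \sum_j C i j * Delta j x)
      & g = ord V (\det C)]].

(* lc(a) and the multiplier ideal, computed on the log resolution M. *)
Definition lc_on (T : realType) R M a : \bar T :=
  ereal_inf [set ((rel_canonical_coef R V + 1)%:~R / (ord_ideal V a)%:R)%:E
    | V in [set V | prime_divisor M V /\ (0 < ord_ideal V a)%N]].

Definition multiplier_ideal_on R M (lambda : rat) a : set K :=
  [set h | h = 0 \/ forall V, prime_divisor M V ->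
     0 <= ord V h + (rel_canonical_coef R V
                     - Num.floor (lambda * (ord_ideal V a)%:R))].

(* "v is lc(a)" and "I is the multiplier ideal of lambda . a": log resolutions
   exist (Hironaka), and the result does not depend on the one used. *)
Definition is_lc (T : realType) R a (v : \bar T) : Prop :=
  exists2 M, log_resolution R a M & v = lc_on T R M a.

Definition is_multiplier_ideal R (lambda : rat) a I : Prop :=
  exists2 M, log_resolution R a M & I = multiplier_ideal_on R M lambda a.

Definition is_asymptotic_multiplier_ideal R (lambda : rat)
    (a : nat -> set K) I : Prop :=
  (exists2 p : nat, (0 < p)%N &
     is_multiplier_ideal R (lambda / p%:R) (a p) I) /\
  (forall (p : nat) I', (0 < p)%N ->
     is_multiplier_ideal R (lambda / p%:R) (a p) I' -> I' `<=` I).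

Definition graded_sequence_of_nonzero_ideals R (a : nat -> set K) : Prop :=
  [/\ forall m, is_ideal R (a m),
      forall m, exists2 x, a m x & x != 0
    & forall p q x y, a p x -> a q y -> a (p + q)%N (x * y)].

End BirationalGeometry.

(* Main.v *)
(* Write c_V = gamma_V + 1 for the log discrepancy of a divisorial valuation V over X.
   The heart is that lc(b) is the infimum of c_V / ord_V(b) over all divisorial V, not only
   over those on the chosen log resolution N.  If V is centered at S in N, with parameters
   x_i adapted to the normal crossings divisor, then
     c_V >= \sum_i c_(x_i) ord_V(x_i),
   because the determinant expressing Der(S) through Der(R) is divisible by
   \prod_i x_i ^ gamma_i and the forms dx_i / x_i acquire only logarithmic poles along V.
   Then lc(a_m) and lc(b_m) are infima over the same set of valuations: the orders of a_m are
   subadditive in m and bounded by a multiple of c_V, so m lc(a_m) tends to its supremum L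
   (Fekete); a_m is contained in b_m; and ord_V(b_m) > (m / p) ord_V(a_p) - c_V for some p and
   the divisors V of a log resolution of a_p, which gives
   m lc(b_m) <= m y / (m - y) for every y > L and all m > y.

   The commutative algebra rests on derivations instead of dimension theory.  A regular system
   of parameters x of S, completed by lifts y of a transcendence basis of the residue field,
   has a dual basis of Der_k(S): Nakayama's lemma shows that a derivation is controlled by its
   values on (x, y), and a chain of primes provides as many algebraically independent elements
   of K, hence enough derivations.  Primality of the ideals (x_j : j in J) then follows by
   differentiating along the x_i with i not in J. *)
Require Import Defs.
From HB Require Import structures.
From mathcomp Require Import all_boot all_order all_algebra.
From mathcomp Require Import all_classical all_reals all_analysis.
From mathcomp Require Import ring lra zify.
Import Order.TTheory GRing.Theory Num.Theory.
Set Implicit Arguments.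
Unset Strict Implicit.
Unset Printing Implicit Defensive.
Local Open Scope classical_set_scope.
Local Open Scope ring_scope.

(** * Subrings and dual numbers *)

Section Subrings.
Variable R : comNzRingType.
Implicit Types (A G : set R) (x y t : R) (p q : {poly R}).

(** No model dominating two others is ever built: each lc and each multiplier ideal comes with its
    own log resolution, and these are compared only through the valuative description. Properness
    enters as the existence of a center of V on such a model.

    The bound of ord_V(a_m) by a multiple e c_V, with e independent of V, is obtained by
    differentiation. Finitely many coordinate derivatives on R turn a fixed nonzero f in a_m into a
    unit. Along V each of them lowers the order by at most c_V: gamma_V for the determinant of df,
    which clears the denominators of the change of basis, and 1 for the logarithmic pole. Without
    this uniformity the remainder terms in Fekete's argument could not be absorbed for all V at
    once.

    The log discrepancy, rather than gamma_V, appears in the estimate for b_m because of the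
    round-down: [q] <= n means q < n + 1.

    Derivations are built through their graphs in K[eps], so that extending a derivation amounts to
    adjoining one element to a ring. *)

Definition subring_set A : Prop := GRing.subring_closed (mem A).

Lemma subring_setP A : subring_set A <->
  [/\ A 1, forall x y, A x -> A y -> A (x - y)
    & forall x y, A x -> A y -> A (x * y)].
Proof.
split=> [[A1 AB AM]|[A1 AB AM]]; split.
- by move: A1; rewrite in_setE.
- by move=> x y Ax Ay; have := AB x y; rewrite !in_setE; apply.
- by move=> x y Ax Ay; have := AM x y; rewrite !in_setE; apply.
- by rewrite in_setE.
- by move=> x y; rewrite !in_setE; apply: AB.
- by move=> x y; rewrite !in_setE; apply: AM.
Qed.

(** The argument [sA] carries the closure proof on which the instance below is keyed, so that the
    [rpred] lemmas apply to a bare set. *)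
Definition subring_pred A (sA : subring_set A) : pred R := mem A.

HB.instance Definition _ A (sA : subring_set A) :=
  GRing.isSubringClosed.Build R (subring_pred sA) sA.

Lemma subring_predE A (sA : subring_set A) x : (x \in subring_pred sA) = (A x) :> Prop.
Proof. exact: in_setE. Qed.

Section Closure.
Variables (A : set R) (sA : subring_set A).
Let inA x : A x <-> x \in subring_pred sA.
Proof. by rewrite subring_predE. Qed.

Lemma subring0 : A 0. Proof. apply/inA; exact: rpred0. Qed.
Lemma subring1 : A 1. Proof. apply/inA; exact: rpred1. Qed.
Lemma subringD x y : A x -> A y -> A (x + y).
Proof. by rewrite !inA; exact: rpredD. Qed.
Lemma subringB x y : A x -> A y -> A (x - y).
Proof. by rewrite !inA; exact: rpredB. Qed.
Lemma subringN x : A x -> A (- x).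
Proof. by rewrite !inA => h; rewrite rpredN. Qed.
Lemma subringM x y : A x -> A y -> A (x * y).
Proof. by rewrite !inA; exact: rpredM. Qed.
Lemma subringX x n : A x -> A (x ^+ n).
Proof. by rewrite !inA => h; rewrite rpredX. Qed.
Lemma subringMn x n : A x -> A (x *+ n).
Proof. by rewrite !inA => h; rewrite rpredMn. Qed.
Lemma subring_nat n : A n%:R. Proof. by apply: subringMn; exact: subring1. Qed.
Lemma subring_sum (I : Type) (r : seq I) (P : pred I) (F : I -> R) :
  (forall i, P i -> A (F i)) -> A (\sum_(i <- r | P i) F i).
Proof. by move=> h; apply/inA/rpred_sum => i /h /inA. Qed.
Lemma subring_prod (I : Type) (r : seq I) (P : pred I) (F : I -> R) :
  (forall i, P i -> A (F i)) -> A (\prod_(i <- r | P i) F i).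
Proof. by move=> h; apply/inA/rpred_prod => i /h /inA. Qed.
End Closure.

Definition poly_over A p := forall i, A p`_i.

Lemma poly_overP A (sA : subring_set A) p :
  poly_over A p <-> p \is a polyOver (subring_pred sA).
Proof.
split=> [h|/polyOverP h i]; first by apply/polyOverP => i; rewrite subring_predE.
by rewrite -(subring_predE sA); apply: h.
Qed.

Definition adjoin A t : set R := [set x | exists2 p, poly_over A p & x = p.[t]].

Section Adjoin.
Variables (A : set R) (sA : subring_set A) (t : R).
Local Notation P := (poly_overP sA).

Lemma adjoin_subring : subring_set (adjoin A t).
Proof.
apply/subring_setP; split.
- by exists 1; rewrite ?hornerC //; apply/P/rpred1.
- move=> _ _ [p /P pA ->] [q /P qA ->]; exists (p - q); rewrite ?hornerE //.
  by apply/P/rpredB.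
- move=> _ _ [p /P pA ->] [q /P qA ->]; exists (p * q); rewrite ?hornerM //.
  by apply/P/rpredM.
Qed.

Lemma sub_adjoin : A `<=` adjoin A t.
Proof.
move=> x Ax; exists x%:P; rewrite ?hornerC //.
by apply/P; rewrite polyOverC subring_predE.
Qed.

Lemma mem_adjoin : adjoin A t t.
Proof. by exists 'X; rewrite ?hornerX //; apply/P/polyOverX. Qed.
End Adjoin.

Lemma adjoin_min A B t : subring_set B -> A `<=` B -> B t -> adjoin A t `<=` B.
Proof.
move=> sB AB Bt _ [p pA ->]; rewrite horner_coef.
apply: (subring_sum sB) => i _; apply: (subringM sB); first exact/AB/pA.
exact: (subringX sB).
Qed.

End Subrings.

Section DualNumbers.
Variable K : fieldType.

(* K[eps], with eps^2 = 0, as pairs (value, derivative). *)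
Definition dual : Type := (K * K)%type.
HB.instance Definition _ := GRing.Zmodule.on dual.
Implicit Types (x y z : dual).

Definition dual_one : dual := (1, 0).
Definition dual_mul x y : dual := (x.1 * y.1, x.1 * y.2 + x.2 * y.1).

Lemma dual_eq x y : x.1 = y.1 -> x.2 = y.2 -> x = y.
Proof. by case: x y => [a b] [c d] /= -> ->. Qed.

Lemma dual_mulA : associative dual_mul.
Proof. by move=> x y z; apply: dual_eq => /=; ring. Qed.
Lemma dual_mulC : commutative dual_mul.
Proof. by move=> x y; apply: dual_eq => /=; ring. Qed.
Lemma dual_mul1 : left_id dual_one dual_mul.
Proof. by move=> x; apply: dual_eq => /=; ring. Qed.
Lemma dual_mulDl : left_distributive dual_mul +%R.
Proof. by move=> x y z; apply: dual_eq => /=; ring. Qed.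
Lemma dual_oner_neq0 : dual_one != 0.
Proof. by apply/eqP => -[] /eqP; rewrite oner_eq0. Qed.

HB.instance Definition _ := GRing.Zmodule_isComNzRing.Build dual
  dual_mulA dual_mulC dual_mul1 dual_mulDl dual_oner_neq0.

Definition dual_val (x : dual) : K := x.1.
Lemma dual_val_is_additive : additive dual_val.
Proof. by move=> x y. Qed.
Lemma dual_val_is_multiplicative : monoid_morphism dual_val.
Proof. by split. Qed.
HB.instance Definition _ := GRing.isZmodMorphism.Build dual K dual_val dual_val_is_additive.
HB.instance Definition _ := GRing.isMonoidMorphism.Build dual K dual_val dual_val_is_multiplicative.

End DualNumbers.

(** * Extension of derivations *)

Section Graphs.
Variable K : fieldType.
Hypothesis K0 : [pchar K] =i pred0.
Implicit Types (G : set (dual K)) (p q : {poly dual K}).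

(* The graph, in K[eps], of a derivation with values in K on the subring
   of K of the first coordinates. *)
Definition deriv_graph G : Prop :=
  subring_set G /\ forall v : K, G ((0, v) : dual K) -> v = 0.

Definition dval_poly p : {poly K} := map_poly (@dual_val K) p.

Lemma dval_horner p t u : (p.[(t, u) : dual K]).1 = (dval_poly p).[t].
Proof. by rewrite -[LHS]/(dual_val _) /dval_poly -horner_map. Qed.

(** First-order Taylor formula p(t + u eps) = p(t) + p'(t) u eps; as eps^2 = 0, only the value part
    of the coefficients reaches the last term. *)
Lemma horner_dual p t u :
  p.[(t, u) : dual K] =
    p.[(t, 0) : dual K] + ((0, (dval_poly p)^`().[t] * u) : dual K).
Proof.
elim/poly_ind: p => [|p c IH].
  by rewrite /dval_poly rmorph0 deriv0 !horner0; apply: dual_eq => /=; ring.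
rewrite !hornerMXaddC IH /dval_poly rmorphD rmorphM /= map_polyX map_polyC.
rewrite derivD derivM derivX derivC !hornerE.
rewrite -[map_poly _ p]/(dval_poly p) -(dval_horner p t 0).
case: p.[_] => a b; case: c => c c'.
apply: dual_eq => /=; ring.
Qed.

(** Single-valuedness makes the first projection injective on [G], hence coefficientwise on
    polynomials over [G]. *)
Lemma dval_poly_eq0 G p : deriv_graph G -> poly_over G p ->
  (dval_poly p == 0) = (p == 0).
Proof.
move=> [sG fG] pG; apply/eqP/eqP => [p0|->]; last by rewrite /dval_poly rmorph0.
apply/polyP => i; rewrite coef0.
have h1 : (p`_i).1 = 0 by rewrite -[LHS]/(dual_val _) -coef_map -/(dval_poly p) p0 coef0.
have := pG i; case: (p`_i) h1 => a b /= -> /fG ->; by [].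
Qed.

Lemma deriv_graph_adjoin_transcendental G t :
  deriv_graph G ->
  (forall p, poly_over G p -> (dval_poly p).[t] = 0 -> p = 0) ->
  forall u, deriv_graph (adjoin G ((t, u) : dual K)).
Proof.
move=> [sG fG] tr u; split; first exact: adjoin_subring.
move=> v [p pG e].
have /(tr p pG) p0 : (dval_poly p).[t] = 0 by rewrite -(dval_horner p t u) -e.
by move: e; rewrite p0 horner0 => -[].
Qed.

Lemma deriv_poly_neq0 (q : {poly K}) : (1 < size q)%N -> q^`() != 0.
Proof.
case e: (size q) => [|[|n]] // _; apply/eqP => /polyP /(_ n).
rewrite coef_deriv coef0 => /eqP; rewrite -mulr_natr mulf_eq0.
have -> : q`_n.+1 = lead_coef q by rewrite lead_coefE e.
by rewrite lead_coef_eq0 -size_poly_eq0 e (proj1 (pcharf0P K) K0).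
Qed.

(** If [t] is transcendental, any derivative will do. Otherwise the derivative is forced by an
    annihilating polynomial of least degree, which is separable in characteristic 0, and it must be
    checked that the other relations impose nothing more. *)
Lemma deriv_graph_adjoin G t :
  deriv_graph G -> exists u, deriv_graph (adjoin G ((t, u) : dual K)).
Proof.
move=> gG; have [sG fG] := gG.
pose Z n := `[< exists p, [/\ poly_over G p, p != 0, (dval_poly p).[t] = 0 & size p = n] >].
case: (pselect (exists n, Z n)) => [exZ|nZ]; last first.
  exists 0; apply: deriv_graph_adjoin_transcendental => // p pG pt.
  apply: contra_notP nZ => /eqP p0; exists (size p); apply/asboolP; exists p; by split.
case: (ex_minnP exZ) => n /asboolP[p0 [p0G p0n0 p0t sp0]] min.
have minP p : poly_over G p -> (dval_poly p).[t] = 0 -> (size p < n)%N -> p = 0.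
  move=> pG pt lt; apply: contraTeq lt => pn0; rewrite -leqNgt.
  by apply: min; apply/asboolP; exists p; split.
have s1 : (1 < size (dval_poly p0))%N.
  rewrite ltnNge; apply/negP => /size1_polyC e.
  move: p0t p0n0; rewrite -(dval_poly_eq0 gG p0G) e hornerC => ->.
  by rewrite eqxx.
pose d := (dval_poly p0)^`().[t].
(* Otherwise the derivative of [p0] would be a shorter nonzero polynomial killing [t]. *)
have d0 : d != 0.
  apply/eqP => d0.
  have e : dval_poly p0^`() = (dval_poly p0)^`() by rewrite /dval_poly deriv_map.
  have pG' : poly_over G p0^`().
    by move=> i; rewrite coef_deriv; exact: (subringMn sG).
  have /minP : (dval_poly p0^`()).[t] = 0 by rewrite e.
  move=> /(_ pG'); rewrite -sp0 lt_size_deriv // => /(_ isT) h.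
  by move: (deriv_poly_neq0 s1); rewrite -e h /dval_poly rmorph0 eqxx.
(* The solution of p0(t + u eps) = 0 given by the Taylor formula. *)
pose u := - (p0.[(t, 0) : dual K]).2 / d.
exists u; set tau := ((t, u) : dual K).
have p0tau : p0.[tau] = 0.
  rewrite /tau horner_dual; apply: dual_eq => /=.
    by rewrite addr0 dval_horner.
  by rewrite -/d /u; field.
(* Every relation on the value [t] already holds at [tau]; this is what single-valuedness of the
   adjoined graph needs. *)
have key m : forall p, poly_over G p -> (size p <= m)%N ->
    (dval_poly p).[t] = 0 -> p.[tau] = 0.
  elim: m => [|m IH] p pG sp pt.
    by move: sp; rewrite leqn0 size_poly_eq0 => /eqP ->; rewrite horner0.
  have [lt|le] := ltnP (size p) n; first by rewrite (minP p) ?horner0.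
  (* Pseudo-division, as [G] is only a ring: the leading terms cancel, and at [tau] only
     [lead_coef p0 * p] survives, whose first factor has nonzero value. *)
  pose r := (lead_coef p0)%:P * p - (lead_coef p)%:P * 'X^(size p - n) * p0.
  have P q := poly_overP sG q.
  have rG : poly_over G r.
    apply/P/rpredB; apply: rpredM;
      rewrite ?rpredM ?rpredX ?polyOverX ?polyOverC ?subring_predE //; try exact/P.
      exact: p0G.
    exact: pG.
  have sr : (size r <= m)%N.
    have n0 : (0 < n)%N by rewrite -sp0 size_poly_gt0.
    apply/leq_sizeP => j jm; rewrite /r coefB coefCM -mulrA coefCM coefXnM.
    have [jp|jp] := ltnP (size p).-1 j.
      rewrite [p`_j]nth_default; last by rewrite (leq_trans (leqSpred _)).
      rewrite mulr0 sub0r; case: ifP => _; rewrite ?mulr0 ?oppr0 //.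
      rewrite nth_default ?mulr0 ?oppr0 // sp0.
      by move: jp le; clear; lia.
    have ep : size p = j.+1.
      apply/eqP; rewrite eqn_leq (leq_trans sp) //=.
      by move: jp; rewrite -ltnS prednK // (leq_trans n0).
    have -> : lead_coef p = p`_j by rewrite lead_coefE ep.
    have -> : lead_coef p0 = p0`_n.-1 by rewrite lead_coefE sp0.
    rewrite ep in le *; rewrite ifN; last by rewrite -leqNgt; lia.
    have -> : (j - (j.+1 - n) = n.-1)%N by move: n0 le; clear; lia.
    ring.
  have rt : (dval_poly r).[t] = 0.
    rewrite -(dval_horner r t u) /r !hornerE -/tau.
    have := dval_horner p t u; rewrite pt -/tau.
    case: p.[tau] => a b /= ->; rewrite p0tau /=; ring.
  have := IH r rG sr rt; rewrite /r !hornerE p0tau mulr0 subr0.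
  have l0 : (lead_coef p0).1 != 0.
    have : poly_over G (lead_coef p0)%:P.
      move=> i; rewrite coefC; case: eqP => _; [exact: p0G|exact: (subring0 sG)].
    move=> /(dval_poly_eq0 gG); rewrite /dval_poly map_polyC !polyC_eq0 /=.
    by rewrite lead_coef_eq0 /dual_val => ->.
  have := dval_horner p t u; rewrite pt -/tau.
  case: p.[tau] => a b /= -> /(congr1 snd) /=; rewrite mulr0 addr0 => /eqP.
  by rewrite mulf_eq0 (negbTE l0) /= => /eqP ->.
split; first exact: adjoin_subring.
move=> v [p pG e].
have pt : (dval_poly p).[t] = 0 by rewrite -(dval_horner p t u) -e.
by move: e; rewrite (key (size p)) // => -[].
Qed.

(** The graph of the extension to fractions by the quotient rule. Membership is tested after
    clearing a denominator of nonzero value, such an element being invertible in K[eps]. *)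
Definition frac_graph G : set (dual K) :=
  [set x | exists h : dual K, [/\ G h, h.1 != 0 & G (h * x)]].

Lemma frac_graphP G : deriv_graph G ->
  deriv_graph (frac_graph G) /\ G `<=` frac_graph G.
Proof.
move=> [sG fG]; split; last first.
  move=> x Gx; exists 1; rewrite mul1r oner_eq0; split => //; exact: (subring1 sG).
split; last first.
  move=> v [h [Gh h0]]; rewrite [h * _](_ : _ = ((0, h.1 * v) : dual K)); last first.
    by apply: dual_eq => /=; ring.
  by move=> /fG /eqP; rewrite mulf_eq0 (negbTE h0) => /eqP.
apply/subring_setP; split.
- by exists 1; rewrite mul1r oner_eq0; split => //; exact: (subring1 sG).
- move=> x y [h [Gh h0 Gx]] [g [Gg g0 Gy]]; exists (h * g); split.
  + exact: (subringM sG).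
  + by rewrite mulf_neq0.
  + rewrite [h * g * _](_ : _ = g * (h * x) - h * (g * y)); last by ring.
    by apply: (subringB sG); apply: (subringM sG).
- move=> x y [h [Gh h0 Gx]] [g [Gg g0 Gy]]; exists (h * g); split.
  + exact: (subringM sG).
  + by rewrite mulf_neq0.
  + rewrite [h * g * _](_ : _ = (h * x) * (g * y)); last by ring.
    by apply: (subringM sG).
Qed.

(** The pair is the inverse of [x] in K[eps]; if [h] is a denominator for [x], then [h * x] is one
    for its inverse. *)
Lemma frac_graphV G (x : dual K) : subring_set G -> frac_graph G x -> x.1 != 0 ->
  frac_graph G ((x.1^-1, - x.2 / x.1 ^+ 2) : dual K).
Proof.
move=> sG [h [Gh h0 Gx]] x0; exists (h * x); split => //.
  by rewrite mulf_neq0.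
rewrite [h * x * _](_ : _ = h) //; apply: dual_eq => /=; by field.
Qed.
End Graphs.

(** * Towers of algebraically independent elements and derivations with prescribed values *)

Section Towers.
Variables (k : closedFieldType) (K : fieldType) (iota : {rmorphism k -> K}).
Hypothesis k0 : [pchar k] =i pred0.

Lemma char0_K : [pchar K] =i pred0.
Proof.
apply/pcharf0P => n; rewrite -(rmorph_nat iota) fmorph_eq0.
exact: (proj1 (pcharf0P k) k0).
Qed.

Lemma subring_range : subring_set (range iota).
Proof.
apply/subring_setP; split.
- by exists 1; rewrite ?rmorph1.
- by move=> _ _ [x _ <-] [y _ <-]; exists (x - y); rewrite ?rmorphB.
- by move=> _ _ [x _ <-] [y _ <-]; exists (x * y); rewrite ?rmorphM.
Qed.

(* Rings k[z_1, ..., z_n] with z_1, ..., z_n algebraically independent. *)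
Inductive tower : set K -> seq K -> Prop :=
| tower_nil : tower (range iota) [::]
| tower_rcons B z t : tower B z ->
    (forall p, poly_over B p -> p.[t] = 0 -> p = 0) ->
    tower (adjoin B t) (rcons z t).

Lemma tower_subring B z : tower B z -> subring_set B.
Proof. by elim => [|{}B {}z t _ sB _]; [exact: subring_range|exact: adjoin_subring]. Qed.

Lemma tower_mem B z : tower B z -> forall x, x \in z -> B x.
Proof.
elim => [//|{}B {}z t tB zB _] x; rewrite mem_rcons inE => /predU1P[->|/zB Bx].
  exact/mem_adjoin/(tower_subring tB).
by apply: sub_adjoin => //; exact: tower_subring tB.
Qed.

Lemma tower_min B z A : tower B z -> subring_set A -> range iota `<=` A ->
  (forall x, x \in z -> A x) -> B `<=` A.
Proof.
elim => [//|{}B {}z t tB IH _] sA cA zA; apply: adjoin_min => //.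
  by apply: IH => // x xz; apply: zA; rewrite mem_rcons inE xz orbT.
by apply: zA; rewrite mem_rcons mem_head.
Qed.

(** A transcendental generator can be given any derivative. Keeping the first coordinates inside [B]
    lets transcendence over [B] be used for polynomials over the graph. *)
Lemma tower_graph B z : tower B z -> forall u : nat -> K,
  exists G : set (dual K), [/\ deriv_graph G, forall x v, G ((x, v) : dual K) -> B x,
    forall c, G ((iota c, 0) : dual K)
    & forall i, (i < size z)%N -> G ((z`_i, u i) : dual K)].
Proof.
elim => [|{}B {}z t tB IH tr] u.
  exists [set x | exists c, x = ((iota c, 0) : dual K)]; split => //.
  - split; last by move=> v [c [_ ->]].
    apply/subring_setP; split.
    + by exists 1; rewrite rmorph1.
    + move=> _ _ [c ->] [d ->]; exists (c - d); rewrite rmorphB.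
      by apply: dual_eq => /=; rewrite ?subr0.
    + move=> _ _ [c ->] [d ->]; exists (c * d); rewrite rmorphM.
      by apply: dual_eq => /=; rewrite ?mulr0 ?mul0r ?addr0.
  - by move=> x v [c [-> _]]; exists c.
  - by move=> c; exists c.
have [G [gG GB Gc Gz]] := IH u; have [sG fG] := gG.
have sB := tower_subring tB.
have pGB p : poly_over G p -> poly_over B (dval_poly p).
  move=> pG i; rewrite coef_map; apply: (GB _ (p`_i).2).
  by have := pG i; case: (p`_i).
exists (adjoin G ((t, u (size z)) : dual K)); split.
- apply: deriv_graph_adjoin_transcendental => // p pG /(tr _ (pGB p pG)) /eqP.
  by rewrite (dval_poly_eq0 gG) // => /eqP.
- move=> x v [p pG /(congr1 fst)]; rewrite dval_horner /= => ->.
  by exists (dval_poly p) => //; apply: pGB.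
- by move=> c; apply: sub_adjoin.
- move=> i; rewrite size_rcons ltnS leq_eqVlt => /predU1P[->|lt].
    by rewrite nth_rcons ltnn eqxx; apply: mem_adjoin.
  by rewrite nth_rcons lt; apply: sub_adjoin => //; apply: Gz.
Qed.

Lemma deriv_graph_extend (s : seq K) (G : set (dual K)) : deriv_graph G ->
  exists G', [/\ deriv_graph G', G `<=` G'
    & forall x, x \in s -> exists v, G' ((x, v) : dual K)].
Proof.
elim: s G => [|t s IH] G gG; first by exists G; split => // x; rewrite in_nil.
have [u gGu] := deriv_graph_adjoin char0_K t gG.
have [G' [gG' GG' sG']] := IH _ gGu; exists G'; split => //.
  by apply: subset_trans GG'; apply: sub_adjoin; exact: (proj1 gG).
move=> x; rewrite inE => /predU1P[->|/sG' //].
by exists u; apply: GG'; apply: mem_adjoin; exact: (proj1 gG).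
Qed.

(* For a local ring S: S is the localization of k[s] at a prime ideal. *)
Definition ess_generated (S : set K) (s : seq K) : Prop :=
  [/\ [set` s] `<=` S, range iota `<=` S & forall B, subring_set B -> range iota `<=` B ->
    [set` s] `<=` B -> (forall x, B x -> units S x -> B x^-1) -> S `<=` B].

Lemma units_neq0 (S : set K) x : units S x -> x != 0.
Proof. by case=> _ [y _]; apply: contra_eq_neq => ->; rewrite mul0r eq_sym oner_eq0. Qed.

(** The derivation is defined on the tower, extended to the finitely many generators [s], then to
    fractions; essential finiteness and the fraction field hypothesis carry it to all of [K]. *)
Lemma derivation_with_values S s B z (u : nat -> K) :
  ess_generated S s -> has_fraction_field_K S -> tower B z ->
  exists D, is_derivation iota D /\ forall i, (i < size z)%N -> D z`_i = u i.
Proof.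
move=> [_ _ gen] fracS tB.
have [G [gG GB Gc Gz]] := tower_graph tB u.
have [G1 [gG1 GG1 Gs]] := deriv_graph_extend s gG.
have [gF G1F] := frac_graphP gG1.
set F := frac_graph G1 in gF G1F; have [sF fF] := gF.
(* The domain of the derivation reached so far; it is closed under inverses, so it contains [S] and
   then [K]. *)
pose L : set K := [set x | exists v, F ((x, v) : dual K)].
have LV x : L x -> L x^-1.
  case: (eqVneq x 0) => [->|x0] [v Fv]; first by rewrite invr0; exists v.
  by have := frac_graphV (proj1 gG1) Fv x0; eexists; eassumption.
have sL : subring_set L.
  apply/subring_setP; split.
  - by exists 0; apply: (subring1 sF).
  - by move=> x y [v Fx] [w Fy]; exists (v - w); apply: (subringB sF Fx Fy).
  - by move=> x y [v Fx] [w Fy]; eexists; apply: (subringM sF Fx Fy).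
have SL : S `<=` L.
  apply: gen => //.
  - by move=> _ [c _ <-]; exists 0; apply/G1F/GG1.
  - by move=> x /= /Gs[v Gv]; exists v; apply: G1F.
  - by move=> x Lx _; apply: LV.
have LT x : exists v, F ((x, v) : dual K).
  have [a [b [Sa Sb b0 ->]]] := fracS x.
  by apply: (subringM sL); [exact: SL|apply/LV/SL].
pose D x := xget 0 [set v : K | F ((x, v) : dual K)].
have FD x : F ((x, D x) : dual K) by apply: (xgetPex 0 (LT x)).
have DE x v : F ((x, v) : dual K) -> D x = v.
  move=> Fv; apply/eqP; rewrite -subr_eq0; apply/eqP/fF.
  by have := subringB sF (FD x) Fv; congr (F _); apply: dual_eq; rewrite /= ?subrr.
exists D; split; last by move=> i lt; apply/DE/G1F/GG1/Gz.
split.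
- by move=> x y; apply: DE; apply: (subringD sF (FD x) (FD y)).
- by move=> x y; apply: DE; rewrite [y * _]mulrC; apply: (subringM sF (FD x) (FD y)).
- by move=> c; apply/DE/G1F/GG1.
Qed.

Lemma prime_ideal_sub (S P : set K) : is_prime_ideal S P -> P `<=` S.
Proof. by case=> -[]. Qed.

Lemma prime_X (S P : set K) x n : subring_set S -> is_prime_ideal S P -> S x -> P (x ^+ n) -> P x.
Proof.
move=> sS [iP P1 PM] Sx; elim: n => [|n IH]; first by rewrite expr0 => /P1.
by rewrite exprS => /PM[]//; exact: (subringX sS).
Qed.

(** If p(t) lies in [P], its constant coefficient lies in [Q], as [t] does, hence vanishes since [B]
    meets [Q] in 0. Then [t] factors out, and [P] is prime without [t]: the degree drops. *)
Lemma tower_step (S P Q : set K) B z t :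
  subring_set S -> tower B z -> B `<=` S ->
  is_prime_ideal S P -> is_prime_ideal S Q -> P `<=` Q -> Q t -> ~ P t ->
  (forall x, B x -> Q x -> x = 0) ->
  [/\ tower (adjoin B t) (rcons z t), adjoin B t `<=` S
    & forall x, adjoin B t x -> P x -> x = 0].
Proof.
move=> sS tB BS pP pQ PQ Qt Pt BQ.
have St : S t by apply: (prime_ideal_sub pQ).
have sB := tower_subring tB.
have AS : adjoin B t `<=` S by apply: adjoin_min.
have [[_ P0 PD PM] P1 PP] := pP; have [[_ Q0 QD QM] Q1 QQ] := pQ.
have key n : forall p : {poly K}, (size p <= n)%N -> poly_over B p -> P p.[t] -> p = 0.
  elim: n => [|n IH] p; first by rewrite leqn0 size_poly_eq0 => /eqP.
  elim/poly_ind: p => [//|p c _] sp pB Pp.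
  have Bc : B c by have := pB 0%N; rewrite coefD coefMX coefC add0r.
  have pB' : poly_over B p.
    by move=> i; have := pB i.+1; rewrite coefD coefMX coefC addr0.
  have Sp : S p.[t] by apply: AS; exists p.
  have c0 : c = 0.
    apply: BQ => //; move: Pp; rewrite hornerMXaddC => /PQ Qp.
    rewrite (_ : c = (p.[t] * t + c) + (- p.[t]) * t); last by ring.
    by apply: QD => //; apply: QM => //; apply: (subringN sS).
  move: Pp sp; rewrite c0 addr0 hornerMX => /PP[]// Pp.
  case: (eqVneq p 0) => [->|p0]; first by rewrite mul0r.
  by rewrite size_mulX // ltnS => sp; move: p0; rewrite (IH p) ?eqxx.
split => //.
  by apply: tower_rcons => // p pB pt; apply: (key (size p)); rewrite ?pt.
by move=> x [p pB ->] /(key _ _ (leqnn _) pB) ->; rewrite horner0.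
Qed.

(** The chain is descended from its largest prime, each strict inclusion giving one new independent
    element; the invariant is that the current ring meets the current prime only in 0. *)
Lemma tower_chain (S : set K) d (Q : nat -> set K) B z :
  subring_set S -> tower B z -> B `<=` S -> prime_chain S d Q ->
  (forall x, B x -> Q d x -> x = 0) ->
  exists B' z', tower B' z' /\ size z' = (size z + d)%N.
Proof.
move=> sS; elim: d B z => [|d IH] B z tB BS [pQ lQ] BQ.
  by exists B, z; rewrite addn0.
have [sub nsub] := lQ d (ltnSn d).
have [t [Qt nQt]] : exists t, Q d.+1 t /\ ~ Q d t.
  apply: contra_notP nsub => h t Qt; apply: contra_notP h => nQ; by exists t.
have [tB' BS' BQ'] := tower_step sS tB BS (pQ d (leqnSn d)) (pQ d.+1 (leqnn _)) sub Qt nQt BQ.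
have [|B' [z' [tz' sz']]] := IH _ _ tB' BS' _ BQ'.
  by split=> i lt; [apply: pQ; exact: leqW|apply: lQ; exact: ltnW].
by exists B', z'; split => //; rewrite sz' size_rcons addSnnS.
Qed.

(* A transcendence basis of the residue field chosen among residues of s. *)
Lemma tower_residue (S m : set K) (s : seq K) :
  subring_set S -> range iota `<=` S -> is_prime_ideal S m -> [set` s] `<=` S ->
  exists B y, [/\ tower B y, B `<=` S, forall x, B x -> m x -> x = 0 &
    forall t, t \in s -> exists p, [/\ poly_over B p, p != 0 & m p.[t]]].
Proof.
move=> sS cS pm; have [[_ m0 mD mM] m1 mP] := pm.
elim: s => [|t s IH] sub.
  exists (range iota), [::]; split => //; first exact: tower_nil.
  move=> _ [c _ <-] mc; apply/eqP; apply: contra_notT m1 => c0.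
  by rewrite -(mulVf c0) -fmorphV; apply: mM => //; apply: cS; eexists.
have [|B [y [tB BS Bm ys]]] := IH.
  by move=> x xs; apply: sub => /=; rewrite inE (xs : x \in s) orbT.
have sB := tower_subring tB.
have St : S t by apply: sub => /=; rewrite mem_head.
case: (pselect (exists p, [/\ poly_over B p, p != 0 & m p.[t]])) => [ex|nex].
  exists B, y; split => // x; rewrite inE => /predU1P[->//|]; exact: ys.
have tr p : poly_over B p -> m p.[t] -> p = 0.
  by move=> pB mp; apply/eqP; apply: contra_notT nex => p0; exists p.
have sAB := sub_adjoin sB t.
have tB' : tower (adjoin B t) (rcons y t).
  by apply: tower_rcons => // p pB pt; apply: tr; rewrite ?pt.
exists (adjoin B t), (rcons y t); split => //.
- exact: adjoin_min.
- by move=> x [p pB ->] /(tr _ pB) ->; rewrite horner0.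
- move=> x; rewrite inE => /predU1P[->|/ys[p [pB p0 mp]]]; last first.
    by exists p; split => // i; apply/sAB/pB.
  (* Once adjoined, [t] is a root of a polynomial over the new ring. *)
  exists ('X - t%:P); rewrite polyXsubC_eq0 hornerXsubC subrr; split => //.
  move=> i; rewrite coefB coefX coefC; have sA := adjoin_subring sB t.
  apply: (subringB sA); first exact: (subring_nat sA).
  by case: eqP => _; [exact: mem_adjoin|exact: (subring0 sA)].
Qed.

End Towers.

(** * Local rings and Nakayama's lemma *)

Section LocalRings.
Variable K : fieldType.
Implicit Types (S I J : set K) (x y : K).

Lemma unitsE S x : subring_set S -> units S x <-> [/\ S x, x != 0 & S x^-1].
Proof.
move=> sS; split=> [ux|[Sx x0 SVx]].
  have x0 := units_neq0 ux; case: ux => Sx [y Sy xy]; split => //.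
  by rewrite (_ : x^-1 = y) // -[y](mulKf x0) xy mulr1.
by split => //; exists x^-1 => //; rewrite divff.
Qed.

Lemma not_unitsE S x : S x -> ~ nonunits S x -> units S x.
Proof. by move=> Sx h; apply: contra_notP h => nu; split. Qed.

Lemma units1 S : subring_set S -> units S 1.
Proof. by move=> sS; split; [exact: (subring1 sS)|exists 1; rewrite ?mulr1 //; exact: (subring1 sS)]. Qed.

Lemma unitsM S x y : subring_set S -> units S x -> units S y -> units S (x * y).
Proof.
move=> sS [Sx [x' Sx' ex]] [Sy [y' Sy' ey]]; split; first exact: (subringM sS).
by exists (x' * y'); [exact: (subringM sS)|rewrite mulrACA ex ey mulr1].
Qed.

Lemma unitsV S x : subring_set S -> units S x -> units S x^-1.
Proof.
by move=> sS /(unitsE _ sS)[Sx x0 Sx']; apply/(unitsE _ sS); rewrite invrK invr_eq0.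
Qed.

Lemma unitsX S x n : subring_set S -> units S x -> units S (x ^+ n).
Proof.
move=> sS ux; elim: n => [|n IH]; first by rewrite expr0; exact: units1.
by rewrite exprS; exact: unitsM.
Qed.

Definition submodule S I : Prop :=
  [/\ I 0, forall x y, I x -> I y -> I (x + y) & forall c x, S c -> I x -> I (c * x)].

Lemma ideal_submodule S I : is_ideal S I -> submodule S I.
Proof. by case. Qed.

Lemma submodule_sum S I (T : Type) (r : seq T) (P : pred T) (F : T -> K) :
  submodule S I -> (forall i, P i -> I (F i)) -> I (\sum_(i <- r | P i) F i).
Proof. by case=> I0 ID _ h; apply: big_ind. Qed.
Arguments submodule_sum {S I T r P F}.

Lemma submoduleN S I x : subring_set S -> submodule S I -> I x -> I (- x).
Proof.
move=> sS [_ _ IM] Ix; rewrite -mulN1r; apply: (IM) => //.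
by apply: (subringN sS); exact: (subring1 sS).
Qed.

Lemma submoduleB S I x y : subring_set S -> submodule S I -> I x -> I y -> I (x - y).
Proof. by move=> sS sI Ix Iy; have [_ ID _] := sI; apply/ID => //; apply: submoduleN sI _. Qed.

Lemma submodule_unit S I u x : subring_set S -> submodule S I -> units S u ->
  I (u * x) -> I x.
Proof.
move=> sS [_ _ IM] uu Iux; rewrite -[x](mulKf (units_neq0 uu)).
by apply: (IM) => //; case: (unitsV sS uu).
Qed.

Lemma self_submodule S : subring_set S -> submodule S S.
Proof. by move=> sS; split; [exact: subring0|move=> ? ?; exact: subringD|move=> ? ?; exact: subringM]. Qed.

Lemma zero_submodule S : submodule S [set 0].
Proof. by split=> // [x y -> ->|c x _ ->]; rewrite /= ?addr0 ?mulr0. Qed.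

Definition add_sets I J : set K := [set v | exists a b, [/\ I a, J b & v = a + b]].

Lemma add_submodule S I J : submodule S I -> submodule S J -> submodule S (add_sets I J).
Proof.
move=> [I0 ID IM] [J0 JD JM]; split.
- by exists 0, 0; rewrite addr0.
- move=> _ _ [a [b [Ia Jb ->]]] [a' [b' [Ia' Jb' ->]]].
  by exists (a + a'), (b + b'); split; [exact: ID|exact: JD|rewrite addrACA].
- move=> c _ Sc [a [b [Ia Jb ->]]].
  by exists (c * a), (c * b); split; [exact: IM|exact: JM|rewrite mulrDr].
Qed.

Definition combinations J (r : nat) (w : nat -> K) : set K :=
  [set v | exists c : nat -> K, (forall j, J (c j)) /\ v = \sum_(j < r) c j * w j].

Lemma combinations_submodule S J r w : submodule S J -> submodule S (combinations J r w).
Proof.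
move=> [J0 JD JM]; split.
- by exists (fun=> 0); split => //; rewrite big1 // => i _; rewrite mul0r.
- move=> _ _ [c [Jc ->]] [d [Jd ->]]; exists (fun i => c i + d i); split=> [i|].
    exact: JD.
  by rewrite -big_split; apply: eq_bigr => i _; rewrite mulrDl.
- move=> a _ Sa [c [Jc ->]]; exists (fun i => a * c i); split=> [i|].
    exact: JM.
  by rewrite mulr_sumr; apply: eq_bigr => i _; rewrite mulrA.
Qed.

Lemma combinations_gen J r w i c : J 0 -> J c -> (i < r)%N -> combinations J r w (c * w i).
Proof.
move=> J0 Jc lt; exists (fun j => if j == i then c else 0); split.
  by move=> j; case: eqP.
rewrite (bigD1 (Ordinal lt)) //= eqxx big1 ?addr0 // => j.
by rewrite -val_eqE /= => /negbTE ->; rewrite mul0r.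
Qed.

Lemma local_prime S : is_local_ring S -> is_prime_ideal S (nonunits S).
Proof.
move=> [sS iS]; split => //.
  by case=> _; apply; exact: units1.
move=> x y Sx Sy [Sxy nu]; case: (pselect (nonunits S x)); first by left.
move=> /(not_unitsE Sx) ux; right; split => // uy; apply: nu.
exact: unitsM.
Qed.

Lemma local_1B S x : is_local_ring S -> nonunits S x -> units S (1 - x).
Proof.
move=> lS nx; have [[iS m1 _]] := (local_prime lS, lS); case=> sS _.
have [mS m0 mD mM] := iS.
apply: not_unitsE; first exact: (subringB sS (subring1 sS) (mS _ nx)).
by move=> h; apply: m1; rewrite -[1](subrK x); exact: mD.
Qed.

(** Elimination of the last generator: its own coefficient c is a nonunit, so 1 - c is a unit and
    the generator can be solved for and substituted in the other relations. *)
Theorem nakayama S I r (w : nat -> K) : is_local_ring S -> submodule S I ->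
  (forall i, (i < r)%N -> add_sets I (combinations (nonunits S) r w) (w i)) ->
  forall i, (i < r)%N -> I (w i).
Proof.
move=> lS sI; have [sS iS] := lS; have sm := ideal_submodule iS.
have [I0 ID IM] := sI.
elim: r => [//|r IH] h.
have sub : forall v, combinations (nonunits S) r w v ->
    add_sets I (combinations (nonunits S) r w) v.
  by move=> v cv; exists 0, v; rewrite add0r.
have sA : submodule S (add_sets I (combinations (nonunits S) r w)).
  exact/add_submodule/combinations_submodule.
have [A0 AD AM] := sA.
have Aw : add_sets I (combinations (nonunits S) r w) (w r).
  have [a [b [Ia [c [cm ->]] e]]] := h r (ltnSn r).
  apply: (submodule_unit sS sA (local_1B lS (cm r))).
  exists a, (\sum_(j < r) c j * w j); split => //; first by exists c.
  by rewrite mulrBl mul1r [X in X - _]e big_ord_recr /= addrA addrK.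
have Iw i : (i < r)%N -> I (w i).
  apply: IH => {}i lt; have [a [b [Ia [c [cm ->]] ->]]] := h i (ltnW lt).
  rewrite big_ord_recr /=; apply: (AD).
    by exists a, 0; rewrite addr0; split => //; case: (combinations_submodule r w sm).
  apply: (AD); first by apply: sub; exists c.
  by apply: (AM) => //; case: (cm r).
move=> i; rewrite ltnS leq_eqVlt => /predU1P[->|]; last exact: Iw.
have [a [b [Ia [c [cm ->]] ->]]] := Aw; apply: (ID) => //.
by apply: (submodule_sum sI) => j _; apply: (IM); [case: (cm j)|exact: Iw].
Qed.

Lemma ideal_genP S d (x : 'I_d -> K) f : subring_set S -> (forall i, S (x i)) ->
  ideal_gen S (range x) f <->
  exists c : 'I_d -> K, (forall i, S (c i)) /\ f = \sum_i c i * x i.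
Proof.
move=> sS Sx; split.
- apply: (smallest_sub (X := [set f | exists c : 'I_d -> K, (forall i, S (c i)) /\ f = \sum_i c i * x i])).
    split.
    + by move=> _ [c [Sc ->]]; apply: (subring_sum sS) => i _; apply: (subringM sS).
    + by exists (fun=> 0); split=> [_|]; [exact: (subring0 sS)|rewrite big1 // => i _; rewrite mul0r].
    + move=> _ _ [c [Sc ->]] [c' [Sc' ->]]; exists (fun i => c i + c' i); split=> [i|].
        exact: (subringD sS).
      by rewrite -big_split; apply: eq_bigr => i _; rewrite mulrDl.
    + move=> a _ Sa [c [Sc ->]]; exists (fun i => a * c i); split=> [i|].
        exact: (subringM sS).
      by rewrite mulr_sumr; apply: eq_bigr => i _; rewrite mulrA.
  move=> _ [i _ <-]; exists (fun j => (j == i)%:R); split=> [j|]; first exact: (subring_nat sS).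
  by rewrite (bigD1 i) //= eqxx mul1r big1 ?addr0 // => j /negbTE ->; rewrite mul0r.
- move=> [c [Sc ->]] J [iJ xJ]; have [_ _ _ JM] := iJ.
  apply: (submodule_sum (ideal_submodule iJ)) => i _; apply: (JM) => //.
  by apply: xJ; exists i.
Qed.

Lemma ideal_gen_ideal S (X : set K) : subring_set S -> X `<=` S -> is_ideal S (ideal_gen S X).
Proof.
move=> sS XS; split.
- apply: smallest_sub => //; have [? ? ?] := self_submodule sS; by split.
- by move=> J [[]].
- by move=> x y hx hy J hJ; have [[_ _ JD _] _] := hJ; apply: JD; [exact: hx|exact: hy].
- by move=> c x Sc hx J hJ; have [[_ _ _ JM] _] := hJ; apply: JM => //; exact: hx.
Qed.

Lemma ideal_gen1P S t f : subring_set S -> S t ->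
  ideal_gen S [set t] f <-> exists2 c, S c & f = c * t.
Proof.
move=> sS St; split.
- apply: (smallest_sub (X := [set f | exists2 c, S c & f = c * t])).
    split.
    + by move=> _ [c Sc ->]; apply: (subringM sS).
    + by exists 0; [exact: (subring0 sS)|rewrite mul0r].
    + by move=> _ _ [c Sc ->] [c' Sc' ->]; exists (c + c'); [exact: (subringD sS)|rewrite mulrDl].
    + by move=> a _ Sa [c Sc ->]; exists (a * c); [exact: (subringM sS)|rewrite mulrA].
  by move=> _ ->; exists 1; [exact: (subring1 sS)|rewrite mul1r].
- by move=> [c Sc ->] J [[_ _ _ JM] tJ]; apply: (JM) => //; apply: tJ.
Qed.

End LocalRings.
Arguments submodule_sum {K S I T r P F}.

(** * Derivations of the function field and their values on a local ring *)

Section Derivations.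
Variables (k : closedFieldType) (K : fieldType) (iota : {rmorphism k -> K}).
Hypothesis k0 : [pchar k] =i pred0.
Variable E : K -> K.
Hypothesis dE : is_derivation iota E.

Lemma derD x y : E (x + y) = E x + E y. Proof. by case: dE. Qed.
Lemma derM x y : E (x * y) = x * E y + y * E x. Proof. by case: dE. Qed.
Lemma der_const c : E (iota c) = 0. Proof. by case: dE. Qed.
Lemma der0 : E 0 = 0. Proof. by rewrite -[in LHS](rmorph0 iota) der_const. Qed.
Lemma der1 : E 1 = 0. Proof. by rewrite -[in LHS](rmorph1 iota) der_const. Qed.
Lemma derN x : E (- x) = - E x.
Proof. by apply/eqP; rewrite -addr_eq0 -derD addNr der0. Qed.
Lemma derB x y : E (x - y) = E x - E y.
Proof. by rewrite derD derN. Qed.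
Lemma der_sum (T : Type) (r : seq T) (P : pred T) (F : T -> K) :
  E (\sum_(i <- r | P i) F i) = \sum_(i <- r | P i) E (F i).
Proof. exact: (big_morph E derD der0). Qed.
Lemma derV x : x != 0 -> E x^-1 = - E x / x ^+ 2.
Proof.
move=> x0; have := derM x x^-1; rewrite divff // der1 => /eqP.
rewrite eq_sym addr_eq0 => /eqP h; rewrite -[E x^-1](mulKf x0) h; by field.
Qed.
Lemma der_div x y : y != 0 -> E (x / y) = (E x * y - x * E y) / y ^+ 2.
Proof. by move=> y0; rewrite derM derV //; field. Qed.
Lemma derX x n : E (x ^+ n.+1) = n.+1%:R * x ^+ n * E x.
Proof.
elim: n => [|n IH]; first by rewrite expr1 expr0 mulr1 mul1r.
rewrite exprS derM IH exprS -[in RHS]natr1 -[n.+1%:R]natr1; ring.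
Qed.

Lemma der_ratio_in (S A : set K) a b : subring_set S -> A `<=` S -> A a -> A b -> S b^-1 ->
  (forall x, A x -> S (E x)) -> S (E (a / b)).
Proof.
move=> sS AS Aa Ab Sb EA; case: (eqVneq b 0) => [->|b0].
  by rewrite invr0 mulr0 der0; exact: (subring0 sS).
rewrite der_div // -exprVn; apply: (subringM sS); last exact: (subringX sS).
by apply: (subringB sS); apply: (subringM sS) => //; [exact: EA|exact: AS|exact: AS|exact: EA].
Qed.

Lemma der_horner (S I : set K) (p : {poly K}) t : subring_set S -> submodule S I ->
  S t -> (forall i, I (E p`_i)) -> I (E p.[t] - p^`().[t] * E t).
Proof.
move=> sS [I0 ID IM] St; elim/poly_ind: p => [|p c IH] pI.
  by rewrite deriv0 !horner0 der0 mul0r subr0.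
rewrite derivD derivM derivX derivC !hornerE derD derM.
rewrite (_ : _ - _ = t * (E p.[t] - p^`().[t] * E t) + E c); last by ring.
apply: (ID).
  by apply: (IM) => //; apply: IH => i; have := pI i.+1; rewrite coefD coefMX coefC addr0.
by have := pI 0%N; rewrite coefD coefMX coefC add0r.
Qed.

Section IntoSubmodule.
Variables (S : set K) (s : seq K) (d : nat) (x : 'I_d -> K) (B : set K) (y : seq K).
Hypotheses (lS : is_local_ring S) (gS : ess_generated iota S s).
Hypotheses (Sx : forall i, S (x i)) (mx : nonunits S = ideal_gen S (range x)).
Hypotheses (tB : tower iota B y) (BS : B `<=` S).
Hypothesis Bm : forall f, B f -> nonunits S f -> f = 0.
Hypothesis ys : forall t, t \in s ->
  exists p, [/\ poly_over B p, p != 0 & nonunits S p.[t]].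

(** For a polynomial of least size with p(t) in the maximal ideal, the derivative is nonzero in
    characteristic 0 and shorter, so its value at [t] is a unit. *)
Lemma separable_residue t : t \in s ->
  exists p, [/\ poly_over B p, nonunits S p.[t] & units S p^`().[t]].
Proof.
move=> ts; have [sS iS] := lS; have sB := tower_subring tB.
pose Z n := `[< exists p, [/\ poly_over B p, p != 0, nonunits S p.[t] & size p = n] >].
have exZ : exists n, Z n.
  by have [p [pB p0 pm]] := ys ts; exists (size p); apply/asboolP; exists p.
case: (ex_minnP exZ) => n /asboolP[p [pB p0 pm sp]] min.
have pB' : poly_over B p^`() by move=> i; rewrite coef_deriv; exact: (subringMn sB).
have St : S t by case: gS => sub _ _; apply: sub.
exists p; split => //; apply: not_unitsE.
  rewrite horner_coef; apply: (subring_sum sS) => i _; apply: (subringM sS); last exact: (subringX sS).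
  exact: BS.
move=> nu; have p'0 : p^`() != 0.
  apply: (deriv_poly_neq0 (char0_K iota k0)); rewrite ltnNge; apply/negP => /size1_polyC e.
  move: pm p0; rewrite e hornerC => /Bm ->; rewrite ?polyC0 ?eqxx //; exact: pB.
have /min : Z (size p^`()) by apply/asboolP; exists p^`().
by rewrite leqNgt -sp lt_size_deriv.
Qed.

(** For a generator t and its separable p, the element p(t) is a combination of the parameters x_l.
    Applying E, and using that E maps [B] and the x_l into [I], one finds p'(t) E(t) in I + m W,
    where W is spanned by E(s). As p'(t) is a unit, Nakayama's lemma applies. *)
Lemma derivation_into I : submodule S I -> (forall i, I (E (x i))) ->
  (forall t, t \in y -> I (E t)) -> forall f, S f -> I (E f).
Proof.
move=> sI Ix Iy; have [sS iS] := lS; have [I0 ID IM] := sI.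
have sm := ideal_submodule iS.
have [subs cS gen] := gS.
have IB f : B f -> I (E f).
  move=> Bf; have /(_ f Bf)[] // : B `<=` [set f | S f /\ I (E f)].
  apply: (tower_min tB).
  - apply/subring_setP; split.
    + by split; [exact: (subring1 sS)|rewrite der1].
    + move=> a b [Sa Ia] [Sb Ib]; split; first exact: (subringB sS).
      by rewrite derB; apply: (submoduleB sS sI).
    + move=> a b [Sa Ia] [Sb Ib]; split; first exact: (subringM sS).
      by rewrite derM; apply: (ID); apply: (IM).
  - by move=> _ [c _ <-]; split; [apply: cS; exists c|rewrite der_const].
  - by move=> t ty; split; [exact/BS/(tower_mem tB)|exact: Iy].
(* Finitely many generators for the values of E on [S]: the finiteness that Nakayama's lemma
   requires. *)
pose w j := E s`_j; pose W J := combinations J (size s) w.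
have sW : submodule S (W S) by apply/combinations_submodule/self_submodule.
have sWm : submodule S (W (nonunits S)) by apply: combinations_submodule.
have [W0 WD WM] := sW.
have ES f : S f -> W S (E f).
  move=> Sf; have /(_ f Sf)[] // : S `<=` [set f | S f /\ W S (E f)].
  apply: gen.
  - apply/subring_setP; split.
    + by split; [exact: (subring1 sS)|rewrite der1].
    + move=> a b [Sa Ia] [Sb Ib]; split; first exact: (subringB sS).
      by rewrite derB; apply: (submoduleB sS sW).
    + move=> a b [Sa Ia] [Sb Ib]; split; first exact: (subringM sS).
      by rewrite derM; apply: (WD); apply: (WM).
  - by move=> _ [c _ <-]; split; [apply: cS; exists c|rewrite der_const].
  - move=> t /= ts; split; first exact: subs.
    rewrite -[t in E t](nth_index 0 ts) -[E _]mul1r.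
    apply: (combinations_gen w); [exact: (subring0 sS)|exact: (subring1 sS)|].
    by rewrite index_mem.
  - move=> a [Sa Wa] ua; have /(unitsE _ sS)[_ a0 Sa'] := ua; split => //.
    rewrite derV // mulrC mulrN; apply: (submoduleN sS sW); apply: (WM) => //.
    by rewrite -exprVn; apply: (subringX sS).
have sM : submodule S (add_sets I (W (nonunits S))) by apply: add_submodule.
have [M0 MD MM] := sM.
have IM' v : I v -> add_sets I (W (nonunits S)) v.
  by move=> Iv; exists v, 0; rewrite addr0; split => //; case: sWm.
have Es i : (i < size s)%N -> I (w i).
  apply: (nakayama lS sI) => {}i lt.
  have ts : s`_i \in s by rewrite mem_nth.
  have St : S s`_i by apply: subs.
  have [p [pB pm up]] := separable_residue ts.
  apply: (submodule_unit sS sM up).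
  have h : I (E p.[s`_i] - p^`().[s`_i] * E s`_i).
    by apply: (der_horner sS sI) => // j; apply/IB/pB.
  rewrite /w (_ : _ * _ = E p.[s`_i] - (E p.[s`_i] - p^`().[s`_i] * E s`_i)); last by ring.
  apply: (submoduleB sS sM); last exact: IM'.
  have : ideal_gen S (range x) p.[s`_i] by rewrite -mx.
  move=> /(ideal_genP _ sS Sx)[c [Sc ->]].
  rewrite der_sum; apply: (submodule_sum sM) => l _; rewrite derM; apply: (MD).
    by apply/IM'/IM.
  exists 0, (x l * E (c l)); rewrite add0r; split => //.
  have [c' [Sc' ->]] := ES _ (Sc l).
  exists (fun j => c' j * x l); split.
    move=> j; have [_ _ _ mM] := iS; apply: (mM) => //.
    by rewrite mx; apply/(ideal_genP _ sS Sx); exists (fun i => (i == l)%:R); split;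
      [move=> ?; exact: (subring_nat sS)
      |rewrite (bigD1 l) //= eqxx mul1r big1 ?addr0 // => j' /negbTE ->; rewrite mul0r].
  by rewrite mulr_sumr; apply: eq_bigr => j _; rewrite mulrA [x l * _]mulrC.
move=> f /ES[c [Sc ->]]; apply: (submodule_sum sI) => j _.
by apply: (IM) => //; apply: Es.
Qed.

End IntoSubmodule.
End Derivations.

(** * Coordinates on a smooth local ring *)

Section Coordinates.
Variables (k : closedFieldType) (K : fieldType) (iota : {rmorphism k -> K}).
Hypothesis k0 : [pchar k] =i pred0.

Lemma derivation_comb n (c : 'I_n -> K) (D : 'I_n -> K -> K) :
  (forall i, is_derivation iota (D i)) ->
  is_derivation iota (fun x => \sum_i c i * D i x).
Proof.
move=> dD; split=> [x y|x y|a].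
- by rewrite -big_split; apply: eq_bigr => i _; rewrite (derD (dD i)) mulrDr.
- rewrite !mulr_sumr -big_split; apply: eq_bigr => i _.
  by rewrite (derM (dD i)) /=; ring.
- by rewrite big1 // => i _; rewrite (der_const (dD i)) mulr0.
Qed.

Lemma derivationB D E : is_derivation iota D -> is_derivation iota E ->
  is_derivation iota (fun x => D x - E x).
Proof.
move=> dD dE; split=> [x y|x y|a].
- by rewrite (derD dD) (derD dE); ring.
- by rewrite (derM dD) (derM dE); ring.
- by rewrite (der_const dD) (der_const dE) subrr.
Qed.

Lemma derivation_eq0 S E : is_derivation iota E -> has_fraction_field_K S ->
  (forall x, S x -> E x = 0) -> forall x, E x = 0.
Proof.
move=> dE fS ES x; have [a [b [Sa Sb b0 ->]]] := fS x.
by rewrite (der_div dE) // !ES // mul0r mulr0 subr0 mul0r.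
Qed.

(** [D i] is the partial derivative along [w i]. The last clause concerns all derivations of [K], so
    [n] is the dimension of Der_k(K) and agrees for all models. *)
Definition coords (S : set K) n (w : 'I_n -> K) (D : 'I_n -> K -> K) : Prop :=
  [/\ forall i, S (w i), forall i, derivation_of iota S (D i),
      forall i j, D i (w j) = (i == j)%:R
    & forall E, is_derivation iota E -> forall x, E x = \sum_i E (w i) * D i x].

Lemma prime_sub_nonunits (S P : set K) : is_prime_ideal S P -> P `<=` nonunits S.
Proof.
move=> [[PS P0 PD PM] P1 _] x Px; split; first exact: PS.
by move=> [Sx [y Sy xy]]; apply: P1; rewrite -xy mulrC; apply: PM.
Qed.

(** The [d + r] independent elements [z] are used to count: they give as many independent
    derivations. A derivation that vanishes on [w] is zero, so the matrix of values of these
    derivations on [w] is invertible, and its inverse turns them into the dual basis of [w]. *)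
Theorem exists_coords S s d (x : 'I_d -> K) :
  is_local_ring S -> ess_generated iota S s -> has_fraction_field_K S ->
  regular_parameters S x ->
  exists r (w : 'I_(d + r) -> K) D, coords S w D /\ forall i, w (lshift r i) = x i.
Proof.
move=> lS gS fS [[[Q chQ] _] mx]; have [sS iS] := lS.
have pm := local_prime lS.
have Sx i : S (x i).
  apply: (prime_ideal_sub pm); rewrite mx => J [_]; apply; by exists i.
have [ss cS _] := gS.
have [B [y [tB BS Bm ys]]] := tower_residue sS cS pm ss.
have [|B' [z [tz sz]]] := tower_chain sS tB BS chQ.
  move=> f Bf Qf; apply: Bm => //; apply: prime_sub_nonunits Qf.
  by case: chQ => + _; apply.
pose r := size y; rewrite addnC -/r in sz.
pose w (i : 'I_(d + r)) : K := match fintype.split i with inl a => x a | inr b => y`_b end.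
have wx i : w (lshift r i) = x i by rewrite /w (unsplitK (inl i)).
have wy (j : 'I_r) : w (rshift d j) = y`_j by rewrite /w (unsplitK (inr j)).
have Sw i : S (w i).
  by rewrite /w; case: (fintype.split i) => [a //|b]; apply/BS/(tower_mem tB)/mem_nth.
have into E I : is_derivation iota E -> submodule S I ->
    (forall i, I (E (w i))) -> forall f, S f -> I (E f).
  move=> dE sI Iw; apply: (derivation_into k0 dE lS gS Sx mx tB BS Bm ys sI).
    by move=> i; rewrite -wx.
  move=> t ty; have lt : (index t y < r)%N by rewrite index_mem.
  by have := Iw (rshift d (Ordinal lt)); rewrite wy /= nth_index.
have zero E : is_derivation iota E -> (forall i, E (w i) = 0) -> forall f, E f = 0.
  move=> dE Ew; apply: (derivation_eq0 dE fS).
  exact: (into _ _ dE (zero_submodule S) Ew).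
have /choice[dl dlP] : forall i : 'I_(d + r), exists D, is_derivation iota D /\
    forall j, (j < size z)%N -> D z`_j = (i == j :> nat)%:R.
  by move=> i; apply: (derivation_with_values k0 _ gS fS tz).
have ddl i : is_derivation iota (dl i) by case: (dlP i).
pose P := \matrix_(i, j) dl i (w j).
have uP : P \in unitmx.
  (* A row relation gives a derivation vanishing on [w], hence zero; evaluating it on [z] recovers
     the coefficients. *)
  rewrite -row_free_unit; apply/inj_row_free => v vP.
  have : forall f, \sum_i v 0 i * dl i f = 0.
    apply: zero; first exact: derivation_comb.
    move=> j; have /rowP/(_ j) := vP; rewrite !mxE => e; rewrite -[RHS]e.
    by apply: eq_bigr => i _; rewrite mxE.
  move=> h; apply/rowP => j; rewrite mxE -(h z`_j) (bigD1 j) //= big1.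
    by rewrite (proj2 (dlP j)) ?sz // eqxx mulr1 addr0.
  move=> i ij; rewrite (proj2 (dlP i)) ?sz //.
  by rewrite [_ == _ :> nat](negbTE ij) mulr0.
pose D i f := \sum_l invmx P i l * dl l f.
have dD i : is_derivation iota (D i) by apply: derivation_comb.
have Dw i j : D i (w j) = (i == j)%:R.
  have /matrixP/(_ i j) := mulVmx uP; rewrite !mxE => <-.
  by apply: eq_bigr => l _; rewrite mxE.
exists r, w, D; split=> //; split=> //.
(* The entries of [invmx P] lie only in [K]; integrality on [S] follows because the values on [w]
   are 0 or 1. *)
- move=> i; split=> //; apply: into => //; first exact: self_submodule.
  by move=> j; rewrite Dw; apply: (subring_nat sS).
- move=> E dE f; apply/eqP; rewrite -subr_eq0; apply/eqP.
  apply: (zero (fun f => E f - \sum_i E (w i) * D i f)).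
    by apply: derivationB => //; apply: derivation_comb.
  move=> j; rewrite (bigD1 j) //= Dw eqxx mulr1 big1 ?addr0 ?subrr //.
  by move=> i ij; rewrite Dw (negbTE ij) mulr0.
Qed.

Section ChangeOfCoordinates.
Variables (S S' : set K) (n n' : nat).
Variables (w : 'I_n -> K) (D : 'I_n -> K -> K) (w' : 'I_n' -> K) (D' : 'I_n' -> K -> K).
Hypotheses (cw : coords S w D) (cw' : coords S' w' D').

Definition jacobian : 'M[K]_(n', n) := \matrix_(i, j) D' i (w j).

Lemma coords_der i : is_derivation iota (D i).
Proof. by case: cw => _ /(_ i)[]. Qed.

Lemma coords_der_in i x : S x -> S (D i x).
Proof. by case: cw => _ /(_ i)[_ h] _ _; exact: h. Qed.

Lemma jacobianP i x : D' i x = \sum_j jacobian i j * D j x.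
Proof.
case: cw => _ _ _ h; rewrite (h (D' i)); last by case: cw' => _ /(_ i)[].
by apply: eq_bigr => j _; rewrite mxE.
Qed.

Lemma jacobian_in A : S `<=` A -> (forall i x, A x -> A (D' i x)) ->
  forall i j, A (jacobian i j).
Proof. by move=> SA DA i j; rewrite mxE; apply/DA/SA; case: cw. Qed.
End ChangeOfCoordinates.

Lemma jacobian_comp S1 S2 S3 n1 n2 n3 (w1 : 'I_n1 -> K) D1 (w2 : 'I_n2 -> K) D2
    (w3 : 'I_n3 -> K) D3 :
  coords S1 w1 D1 -> coords S2 w2 D2 -> coords S3 w3 D3 ->
  jacobian w1 D3 = jacobian w2 D3 *m jacobian w1 D2.
Proof.
move=> c1 c2 c3; apply/matrixP => i j; rewrite !mxE (jacobianP c2 c3).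
by apply: eq_bigr => l _; congr (_ * _); rewrite mxE.
Qed.

Lemma jacobian_id S n (w : 'I_n -> K) D : coords S w D -> jacobian w D = 1%:M.
Proof. by case=> _ _ h _; apply/matrixP => i j; rewrite !mxE h. Qed.

Lemma coords_dim S S' n n' (w : 'I_n -> K) D (w' : 'I_n' -> K) D' :
  coords S w D -> coords S' w' D' -> n = n'.
Proof.
move=> c c'; have e := jacobian_comp c c' c; have e' := jacobian_comp c' c c'.
rewrite (jacobian_id c) in e; rewrite (jacobian_id c') in e'.
apply/eqP; rewrite eqn_leq; apply/andP; split.
  by rewrite -(mxrank1 K n) e (leq_trans (mxrankM_maxr _ _)) ?rank_leq_row.
by rewrite -(mxrank1 K n') e' (leq_trans (mxrankM_maxr _ _)) ?rank_leq_row.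
Qed.

Lemma det_in S n (A : 'M[K]_n) : subring_set S -> (forall i j, S (A i j)) -> S (\det A).
Proof.
move=> sS SA; apply: (subring_sum sS) => s _; apply: (subringM sS).
  by apply: (subringX sS); apply: (subringN sS); apply: (subring1 sS).
exact: (subring_prod sS).
Qed.

Lemma det_units S n (A B : 'M[K]_n) : subring_set S -> (forall i j, S (A i j)) ->
  (forall i j, S (B i j)) -> A *m B = 1%:M -> units S (\det A).
Proof.
move=> sS SA SB e; split; first exact: det_in.
by exists (\det B); [exact: det_in|rewrite -det_mulmx e det1].
Qed.

End Coordinates.

(** * Ideals generated by regular parameters *)

Section RegularParameters.
Variables (k : closedFieldType) (K : fieldType) (iota : {rmorphism k -> K}).
Hypothesis k0 : [pchar k] =i pred0.
Variable S : set K.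
Hypotheses (lS : is_local_ring S) (nS : is_noetherian S) (kS : range iota `<=` S).

Let sS : subring_set S. Proof. by case: lS. Qed.

Lemma units_nat n : units S n.+1%:R.
Proof.
apply/(unitsE _ sS); split.
- exact: (subring_nat sS).
- by rewrite (proj1 (pcharf0P K) (char0_K iota k0)).
- by apply: kS; exists (n.+1%:R^-1) => //; rewrite fmorphV rmorph_nat.
Qed.

Lemma units_fact n : units S (n`!)%:R.
Proof. by rewrite -(prednK (fact_gt0 n)); exact: units_nat. Qed.

Lemma ideal_gen_combinations (s : seq K) : [set` s] `<=` S ->
  ideal_gen S [set` s] `<=` combinations S (size s) (nth 0 s).
Proof.
move=> ss; apply: smallest_sub.
  have [C0 CD CM] := combinations_submodule (size s) (nth 0 s) (self_submodule sS).
  split=> // _ [c [Sc ->]]; apply: (subring_sum sS) => i _; apply: (subringM sS) => //.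
  by apply: ss => /=; apply: mem_nth.
move=> t /= ts; rewrite -[t](nth_index 0 ts) -[nth _ _ _]mul1r.
apply: (combinations_gen (nth 0 s)); [exact: (subring0 sS)|exact: (subring1 sS)|].
by rewrite index_mem.
Qed.

(** N is finitely generated as [S] is noetherian, and N is contained in I + t N. This takes the
    place of Krull's intersection theorem below. *)
Lemma ideal_nakayama (I N : set K) t : submodule S I -> is_ideal S N -> nonunits S t ->
  (forall f, N f -> exists g h, [/\ I g, N h & f = g + t * h]) -> N `<=` I.
Proof.
move=> sI iN mt h; have [s eN] := nS iN.
have [[NS _ _ _] [_ iS]] := (iN, lS); have [_ _ _ mM] := iS.
have sN : [set` s] `<=` N by rewrite eN; exact: sub_gen_smallest.
have ss : [set` s] `<=` S by exact: subset_trans NS.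
have NC f : N f -> combinations S (size s) (nth 0 s) f.
  by rewrite eN; exact: ideal_gen_combinations.
have Is i : (i < size s)%N -> I s`_i.
  apply: (nakayama lS sI) => {}i lt.
  have [|g [f [Ig Nf ->]]] := h s`_i; first by apply: sN; exact: mem_nth.
  exists g, (t * f); split => //; have [c [Sc ->]] := NC _ Nf.
  exists (fun j => c j * t); split=> [j|]; first exact: mM.
  by rewrite mulr_sumr; apply: eq_bigr => j _; ring.
move=> f /NC[c [Sc ->]]; apply: (submodule_sum sI) => i _.
by have [_ _ IM] := sI; apply: IM => //; exact: Is.
Qed.

Lemma der_iter_in (E : K -> K) I n f : (forall x, I x -> I (E x)) -> I f -> I (iter n E f).
Proof. by move=> h If; elim: n => //= n; exact: h. Qed.

Lemma der_iterD (E : K -> K) n f g : is_derivation iota E ->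
  iter n E (f + g) = iter n E f + iter n E g.
Proof. by move=> dE; elim: n => //= n ->; rewrite (derD dE). Qed.

(** By induction, from E(t^(n+1) c) = t^n ((n+1) c + t E(c)). *)
Lemma der_iterX (E : K -> K) t : derivation_of iota S E -> S t -> E t = 1 ->
  forall n c, S c -> exists2 c', S c' & iter n E (t ^+ n * c) = n`!%:R * c + t * c'.
Proof.
move=> [dE ES] St Et; elim=> [|n IH] c Sc.
  by exists 0; [exact: (subring0 sS)|rewrite /= fact0 mulr0 addr0].
have SEc := ES _ Sc.
have [|c' Sc' e] := IH (n.+1%:R * c + t * E c).
  by apply: (subringD sS); apply: (subringM sS) => //; exact: (subring_nat sS).
exists (n`!%:R * E c + c').
  by apply: (subringD sS) => //; apply: (subringM sS) => //; exact: (subring_nat sS).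
rewrite iterSr (derM dE) (derX dE) Et.
rewrite (_ : _ + _ = t ^+ n * (n.+1%:R * c + t * E c)); last by rewrite exprS; ring.
by rewrite e factS natrM; ring.
Qed.

Definition principal t : set K := [set f | exists2 c, S c & f = t * c].

(* One step of the descent along a regular sequence: a derivation which is
   "transversal" to t and preserves I replaces the dimension theory. *)
Section Step.
Variables (I : set K) (t : K) (E : K -> K).
Hypotheses (iI : is_ideal S I) (pI : is_prime_ideal S (add_sets I (principal t))).
Hypotheses (mt : nonunits S t) (dE : derivation_of iota S E).
Hypotheses (EI : forall f, I f -> I (E f)) (Et : E t = 1).

Let St : S t. Proof. by case: mt. Qed.
Let I0 : I 0. Proof. by case: iI. Qed.
Let IM c x : S c -> I x -> I (c * x). Proof. by case: iI => _ _ _; apply. Qed.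
Let sI : submodule S I. Proof. exact: ideal_submodule. Qed.
Let I' := add_sets I (principal t).
Let II' f : I f -> I' f.
Proof.
move=> If; exists f, 0; split; rewrite ?addr0 //; exists 0; rewrite ?mulr0 //.
exact: (subring0 sS).
Qed.
Let tI' c : S c -> I' (t * c).
Proof. by move=> Sc; exists 0, (t * c); rewrite add0r; split => //; exists c. Qed.
Let sI' : submodule S I'. Proof. by apply: ideal_submodule; case: pI. Qed.

Lemma iter_unit_mod n c : S c -> I' (iter n E (t ^+ n * c)) -> I' c.
Proof.
move=> Sc; have [c' Sc' ->] := der_iterX dE St Et n Sc => h.
apply: (submodule_unit sS sI' (units_fact n)).
rewrite (_ : _ * c = n`!%:R * c + t * c' - t * c'); last by ring.
by apply: (submoduleB sS sI') => //; exact: tI'.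
Qed.

(** If t^n c is in the E-stable ideal [I], applying E n times gives n! c in I + (t). So the ideal N
    of t-power torsion modulo [I] satisfies N <= I + t N, and Nakayama's lemma ends the argument. *)
Lemma regular_mod n c : S c -> I (t ^+ n * c) -> I c.
Proof.
move=> Sc Ic; pose N := [set c | S c /\ exists n, I (t ^+ n * c)].
suff /(_ c) : N `<=` I by apply; split => //; exists n.
apply: (ideal_nakayama sI _ mt); first split.
- by move=> ? [].
- by split; [exact: (subring0 sS)|exists 0%N; rewrite mulr0].
- move=> x y [Sx [a Ix]] [Sy [b Iy]]; split; first exact: (subringD sS).
  exists (a + b)%N; rewrite mulrDr; have [_ ID _] := sI; apply: ID.
    by rewrite addnC exprD -mulrA; apply: IM => //; exact: (subringX sS).
  by rewrite exprD -mulrA; apply: IM => //; exact: (subringX sS).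
- move=> a x Sa [Sx [b Ix]]; split; first exact: (subringM sS).
  by exists b; rewrite mulrCA; exact: IM.
- move=> f [Sf [a If]].
  have : I' f by apply: (iter_unit_mod (n := a)) => //; apply: II'; exact: der_iter_in.
  case=> g [_ [Ig [h Sh ->]]] e; exists g, h; split => //; split => //.
  exists a.+1; rewrite exprSr -mulrA.
  rewrite (_ : _ * _ = t ^+ a * f - t ^+ a * g); last by rewrite e; ring.
  by apply: (submoduleB sS sI) => //; apply: IM => //; exact: (subringX sS).
Qed.

(** The t-adic order modulo [I] is finite outside [I]: the intersection of the ideals I + (t^n) is
    stable under division by [t], thanks to [regular_mod], so it equals [I]. *)
Lemma not_mod_decomposition f : S f -> ~ I f ->
  exists n g c, [/\ I g, S c, ~ I' c & f = g + t ^+ n * c].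
Proof.
move=> Sf nIf; pose M n := [set f | exists g c, [/\ I g, S c & f = g + t ^+ n * c]].
pose Z := [set f | S f /\ forall n, M n f].
have ZI : Z `<=` I.
  apply: (ideal_nakayama sI _ mt); first split.
  - by move=> ? [].
  - split=> [|n]; first exact: (subring0 sS).
    by exists 0, 0; rewrite mulr0 addr0; split=> //; exact: (subring0 sS).
  - move=> x y [Sx Mx] [Sy My]; split=> [|n]; first exact: (subringD sS).
    have [[g [c [Ig Sc ->]]] [g' [c' [Ig' Sc' ->]]]] := (Mx n, My n).
    exists (g + g'), (c + c'); split; [by have [_ ID _] := sI; apply: ID|exact: (subringD sS)|ring].
  - move=> a x Sa [Sx Mx]; split=> [|n]; first exact: (subringM sS).
    have [g [c [Ig Sc ->]]] := Mx n.
    by exists (a * g), (a * c); split; [exact: IM|exact: (subringM sS)|ring].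
  - move=> a [Sa Ma]; have [g [c [Ig Sc ec]]] := Ma 1%N.
    exists g, c; rewrite ec expr1; split=> //; split=> // n.
    have [g' [c' [Ig' Sc' ec']]] := Ma n.+1.
    exists (c - t ^+ n * c'), c'; split=> //; last by ring.
    have S1 : S (c - t ^+ n * c').
      by apply: (subringB sS) => //; apply: (subringM sS) => //; exact: (subringX sS).
    apply: (@regular_mod 1) => //.
    rewrite (_ : _ * _ = g' - g); first exact: (submoduleB sS sI).
    have : g + t ^+ 1 * c = g' + t ^+ n.+1 * c' by rewrite -ec -ec'.
    rewrite expr1 exprS => e.
    by rewrite -[g'](addrK (t * t ^+ n * c')) -e; ring.
have exn : exists n, ~~ `[< M n f >].
  apply: contra_notP nIf => h; apply: ZI; split=> // n.
  by apply: contra_notP h => nM; exists n; apply/asboolPn.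
(* The least failing exponent is not 0, since every element of [S] satisfies [M 0]; its predecessor
   is the order. *)
case: (ex_minnP exn) => -[|n] /asboolPn nM min.
  by case: nM; exists 0, f; rewrite add0r expr0 mul1r.
have /asboolP[g [c [Ig Sc e]]] : `[< M n f >].
  by apply: contraT => /min; rewrite ltnn.
exists n, g, c; split=> // -[g' [_ [Ig' [c' Sc' ->]]]] ec; apply: nM.
exists (g + t ^+ n * g'), c'; split=> //; last by rewrite e ec exprSr; ring.
by have [_ ID _] := sI; apply: ID => //; apply: IM => //; exact: (subringX sS).
Qed.

(** If a and b have orders n and n' modulo [I] and ab is in [I], applying E n + n' times to t^(n+n')
    c c' puts c c' in I + (t), which is prime and contains neither factor. *)
Lemma prime_step : is_prime_ideal S I.
Proof.
have [iI' nI1 pI'] := pI; split=> //; first by move=> I1; apply/nI1/II'.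
move=> a b Sa Sb Iab; apply: contrapT => /not_orP[na nb].
have [n [g [c [Ig Sc nc ea]]]] := not_mod_decomposition Sa na.
have [n' [g' [c' [Ig' Sc' nc' eb]]]] := not_mod_decomposition Sb nb.
have Scc : S (c * c') by exact: (subringM sS).
suff /(pI' c c' Sc Sc')[] : add_sets I (principal t) (c * c') by [].
apply: (iter_unit_mod (n := n + n')) => //; apply: II'; apply: der_iter_in => //.
rewrite (_ : _ * _ = a * b - b * g - (t ^+ n * c) * g'); last by rewrite exprD ea eb; ring.
have StX m : S (t ^+ m) by exact: (subringX sS).
apply: (submoduleB sS sI); last by apply: IM => //; exact: (subringM sS).
by apply: (submoduleB sS sI) => //; apply: IM.
Qed.

Lemma iter_not_mod f : S f -> ~ I f -> exists n, ~ I' (iter n E f).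
Proof.
move=> Sf nf; have [n [g [c [Ig Sc nc ->]]]] := not_mod_decomposition Sf nf.
exists n; rewrite der_iterD; last by case: dE.
have Ign : I' (iter n E g) by apply: II'; exact: der_iter_in.
move=> h; apply: nc; apply: (iter_unit_mod (n := n)) => //.
rewrite (_ : iter n E (_ * _) = iter n E g + iter n E (t ^+ n * c) - iter n E g); last by ring.
exact: (submoduleB sS sI').
Qed.
End Step.

Variables (d : nat) (x : 'I_d -> K) (D : 'I_d -> K -> K).
Hypothesis mx : nonunits S = ideal_gen S (range x).
Hypothesis dD : forall i, derivation_of iota S (D i).
Hypothesis Dx : forall i j, D i (x j) = (i == j)%:R.

Lemma param_nonunit i : nonunits S (x i).
Proof. by rewrite mx => J [_]; apply; exists i. Qed.

Let Sx i : S (x i). Proof. by case: (param_nonunit i). Qed.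

Definition param_ideal (J : {set 'I_d}) : set K :=
  [set f | exists c, (forall i, S (c i)) /\ f = \sum_(i in J) c i * x i].

Lemma param_ideal_ideal J : is_ideal S (param_ideal J).
Proof.
split.
- by move=> _ [c [Sc ->]]; apply: (subring_sum sS) => i _; exact: (subringM sS).
- exists (fun=> 0); split=> [_|]; first exact: (subring0 sS).
  by rewrite big1 // => i _; rewrite mul0r.
- move=> _ _ [c [Sc ->]] [c' [Sc' ->]]; exists (fun i => c i + c' i); split=> [i|].
    exact: (subringD sS).
  by rewrite -big_split; apply: eq_bigr => i _; rewrite mulrDl.
- move=> a _ Sa [c [Sc ->]]; exists (fun i => a * c i); split=> [i|].
    exact: (subringM sS).
  by rewrite mulr_sumr; apply: eq_bigr => i _; rewrite mulrA.
Qed.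

Lemma param_idealU (J : {set 'I_d}) (i : 'I_d) : i \notin J ->
  param_ideal (i |: J) = add_sets (param_ideal J) (principal (x i)).
Proof.
move=> iJ; apply/seteqP; split=> f.
  move=> [c [Sc ->]]; rewrite big_setU1 //= addrC.
  by exists (\sum_(j in J) c j * x j), (c i * x i); split=> //; [exists c|exists (c i); rewrite // mulrC].
move=> [_ [_ [[c [Sc ->]] [a Sa ->] ->]]].
exists (fun j => if j == i then a else c j); split=> [j|]; first by case: eqP.
rewrite big_setU1 //= eqxx addrC mulrC; congr (_ + _).
by apply: eq_bigr => j jJ; case: eqP => // ji; move: iJ; rewrite -ji jJ.
Qed.

Lemma param_idealT : param_ideal finset.setT = nonunits S.
Proof.
rewrite mx; apply/seteqP; split=> f.
  move=> [c [Sc ->]]; apply/(ideal_genP _ sS Sx); exists c; split=> //.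
  by apply: eq_bigl => i; rewrite inE.
move=> /(ideal_genP _ sS Sx)[c [Sc ->]]; exists c; split=> //.
by apply: eq_bigl => i; rewrite inE.
Qed.

Lemma param_ideal_der (J : {set 'I_d}) (i : 'I_d) f : i \notin J -> param_ideal J f -> param_ideal J (D i f).
Proof.
move=> iJ [c [Sc ->]]; exists (fun j => D i (c j)); split=> [j|].
  by have [_ DS] := dD i; exact: DS.
have dDi := proj1 (dD i); rewrite (der_sum dDi); apply: eq_bigr => j jJ.
rewrite (derM dDi) Dx; case: eqP => [ij|_]; last by rewrite mulr0 add0r mulrC.
by move: iJ; rewrite ij jJ.
Qed.

(** Induction from the maximal ideal downwards, removing one parameter x_i at a time with the
    derivation [D i], which preserves the smaller ideal. Both claims go together: the step of the
    second uses primality of the larger ideal. *)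
Lemma param_prime_order (J : {set 'I_d}) :
  is_prime_ideal S (param_ideal J) /\ (forall f, S f -> ~ param_ideal J f ->
    exists l : seq 'I_d, units S (foldl (fun g i => D i g) f l)).
Proof.
have [n] := ubnP #|~: J|; elim: n J => [//|n IH] J sJ.
case: (set_0Vmem (~: J)) => [J0|[i]].
  have -> : J = finset.setT by rewrite -[J]finset.setCK J0 finset.setC0.
  rewrite param_idealT; split; first exact: local_prime.
  by move=> f Sf nf; exists [::]; exact: not_unitsE.
rewrite inE => iJ.
have [|pJ oJ] := IH (i |: J).
  apply: leq_trans _ (sJ : (#|~: J| <= n)%N); apply: proper_card; apply/properP; split.
    by rewrite finset.setCS finset.subsetUr.
  by exists i; rewrite !inE ?eqxx.
rewrite param_idealU // in pJ oJ.
have hI f : param_ideal J f -> param_ideal J (D i f) by exact: param_ideal_der.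
have Di1 : D i (x i) = 1 by rewrite Dx eqxx.
split.
  exact: (prime_step (param_ideal_ideal J) pJ (param_nonunit i) (dD i) hI Di1).
move=> f Sf nf.
have [m nm] := iter_not_mod (param_ideal_ideal J) pJ (param_nonunit i) (dD i) hI Di1 Sf nf.
have [|l ul] := oJ _ _ nm.
  by apply: der_iter_in => //; case: (dD i).
exists (nseq m i ++ l); rewrite foldl_cat.
suff -> : foldl (fun g i => D i g) f (nseq m i) = iter m (D i) f by [].
by elim: m f {Sf nf nm ul} => //= m IHm f; rewrite IHm -iterSr.
Qed.

Lemma param_prime i : is_prime_ideal S (principal (x i)).
Proof.
have [+ _] := param_prime_order [set i]; congr is_prime_ideal.
apply/seteqP; split=> f.
  by move=> [c [Sc ->]]; exists (c i); rewrite // big_set1 mulrC.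
by move=> [c Sc ->]; exists (fun=> c); rewrite big_set1 mulrC.
Qed.

(** The case of no parameters; the length of [l] later bounds the order of [f] along every
    divisor. *)
Lemma param_order f : S f -> f != 0 ->
  exists l : seq 'I_d, units S (foldl (fun g i => D i g) f l).
Proof.
move=> Sf f0; have [_] := param_prime_order finset.set0; apply=> //.
by move=> [c [_ e]]; move: f0; rewrite e big_set0 eqxx.
Qed.

Lemma param_neq0 i : x i != 0.
Proof.
have := Dx i i; rewrite eqxx; apply: contra_eq_neq => ->.
by rewrite (der0 (proj1 (dD i))) eq_sym oner_eq0.
Qed.

(** Differentiating x_i = x_j c along x_i would give 1 = x_j D_i(c), with x_j a nonunit. *)
Lemma param_coprime i j : i != j -> ~ principal (x j) (x i).
Proof.
move=> ij [c Sc e]; have := Dx i i; rewrite eqxx e.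
have dDi := dD i; rewrite (derM (proj1 dDi)) Dx (negbTE ij) mulr0 addr0 => h.
have [_ []] := param_nonunit j; split=> //; exists (D i c) => //.
by case: dDi => _; apply.
Qed.

End RegularParameters.

(** * Discrete valuation rings *)

Section DiscreteValuationRings.
Variable K : fieldType.
Implicit Types (V a : set K) (t h : K).

Definition dvr V t : Prop :=
  [/\ subring_set V, t != 0, V t, nonunits V = ideal_gen V [set t]
    & forall h, h != 0 -> exists e : int, exists2 u, units V u & h = u * t ^ e].

(** The intersection Z of the ideals (t^n) satisfies Z = t Z, so it vanishes by Nakayama's lemma;
    hence every nonzero element has a largest power of [t] as a factor. *)
Lemma dvr_of_noetherian V t : is_local_ring V -> is_noetherian V ->
  has_fraction_field_K V -> nonunits V = ideal_gen V [set t] -> t != 0 -> dvr V t.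
Proof.
move=> lV nV fV mt t0; have [sV _] := lV.
have nt : nonunits V t by rewrite mt => J [_]; apply.
have Vt : V t by case: nt.
split=> // h; have [a [b [Va Vb b0 ->]]] := fV h.
pose M n := [set f | exists2 c, V c & f = c * t ^+ n].
have Z0 f : (forall n, M n f) -> f = 0.
  pose Z := [set f | forall n, M n f].
  have /(_ f) : Z `<=` [set 0]; last by [].
  apply: (ideal_nakayama lV nV (zero_submodule V) _ nt); first split.
  - by move=> g /(_ 0%N)[c Vc ->]; rewrite mulr1.
  - by move=> n; exists 0; rewrite ?mul0r //; exact: (subring0 sV).
  - move=> g g' Mg Mg' n; have [[c Vc ->] [c' Vc' ->]] := (Mg n, Mg' n).
    by exists (c + c'); rewrite ?mulrDl //; exact: (subringD sV).
  - move=> e g Ve Mg n; have [c Vc ->] := Mg n.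
    by exists (e * c); rewrite ?mulrA //; exact: (subringM sV).
  - move=> g Mg; exists 0, (g / t); split=> //; last by rewrite add0r mulrCA divff ?mulr1.
    by move=> n; have [c Vc ->] := Mg n.+1; exists c => //; rewrite exprSr mulrA mulfK.
have dec f : V f -> f != 0 -> exists n : nat, exists2 u, units V u & f = u * t ^+ n.
  move=> Vf f0.
  have exn : exists n, ~~ `[< M n f >].
    apply: contra_notP (elimN eqP f0) => hn; apply: Z0 => n.
    by apply: contra_notP hn => nM; exists n; apply/asboolPn.
  case: (ex_minnP exn) => -[|n] /asboolPn nM min.
    by case: nM; exists f; rewrite ?mulr1.
  have /asboolP[c Vc e] : `[< M n f >].
    by apply: contraT => /min; rewrite ltnn.
  exists n, c => //; apply: not_unitsE => //; rewrite mt => /(ideal_gen1P _ sV Vt)[c' Vc' ec].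
  by apply: nM; exists c' => //; rewrite e ec exprS mulrA.
move=> ab0; have a0 : a != 0 by apply: contraNneq ab0 => ->; rewrite mul0r.
have [[n [u uu ->]] [m [v uv ->]]] := (dec a Va a0, dec b Vb b0).
exists (n%:Z - m%:Z), (u / v); first by apply: (unitsM sV) => //; exact: (unitsV sV).
by rewrite expfzDr // invfM mulrACA -exprnN.
Qed.

Section Order.
Variables (V : set K) (t : K).
Hypothesis dV : dvr V t.

Let sV : subring_set V. Proof. by case: dV. Qed.
Let t0 : t != 0. Proof. by case: dV. Qed.
Let Vt : V t. Proof. by case: dV. Qed.
Let mt : nonunits V = ideal_gen V [set t]. Proof. by case: dV. Qed.

Lemma dvr_nonunit : nonunits V t.
Proof. by rewrite mt => J [_]; apply. Qed.

Lemma dvr_expz_in (e : int) : V (t ^ e) -> 0 <= e.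
Proof.
case: (lerP 0 e) => // e0 Ve; case: dvr_nonunit => _ [].
apply/(unitsE _ sV); split=> //.
rewrite (_ : t^-1 = t ^ e * t ^+ (`|e|.-1)%N); first exact: (subringM sV Ve (subringX sV _ Vt)).
rewrite exprnP -expfzDr // -exprN1; congr (_ ^ _); lia.
Qed.

Lemma unit_expz_eq0 u (e : int) : units V u -> units V (u * t ^ e) -> e = 0.
Proof.
move=> uu uut; have h : units V (t ^ e).
  rewrite -[t ^ e](mulKf (units_neq0 uu)); apply: (unitsM sV) => //.
  exact: (unitsV sV).
apply/eqP; rewrite eq_le; apply/andP; split; last by apply: dvr_expz_in; case: h.
by rewrite -oppr_ge0; apply: dvr_expz_in; rewrite -invr_expz; case: (unitsV sV h).
Qed.

Lemma uniformizer_unit t' : nonunits V = ideal_gen V [set t'] ->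
  exists2 u, units V u & t' = u * t.
Proof.
move=> mt'; have Vt' : V t'.
  by have /= [] : nonunits V t' by rewrite mt' => J [_]; apply.
have : ideal_gen V [set t] t' by rewrite -mt mt' => J [_]; apply.
move=> /(ideal_gen1P _ sV Vt)[c Vc e].
have : ideal_gen V [set t'] t by rewrite -mt' mt => J [_]; apply.
move=> /(ideal_gen1P _ sV Vt')[c' Vc' e'].
exists c => //; split=> //; exists c' => //.
by apply: (mulIf t0); rewrite mul1r {2}e' e; ring.
Qed.

Lemma unitsXz u (e : int) : units V u -> units V (u ^ e).
Proof.
move=> uu; case: e => n; first exact: (unitsX n sV).
by rewrite NegzE -invr_expz; apply/(unitsV sV)/(unitsX n.+1 sV).
Qed.

(** The [xget] inside [ord] may select another uniformizer; it differs from [t] by a unit, which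
    leaves the exponent unchanged. *)
Lemma ord_eq u (e : int) : units V u -> ord V (u * t ^ e) = e.
Proof.
move=> uu; rewrite /ord; set P := [set _ | _].
have : P (xget 0 P) by apply: xgetPex; exists e, t, u.
move: (xget 0 P) => e' [t' [u' [mt' uu' eh]]].
have [v uv et'] := uniformizer_unit mt'.
have u'0 := units_neq0 uu'; have v0 := units_neq0 uv.
apply/eqP; rewrite -subr_eq0 -oppr_eq0 opprB; apply/eqP.
apply: (unit_expz_eq0 uu); rewrite expfzDr // mulrA eh et' expfzMl -invr_expz.
rewrite (_ : _ * _ = u' * v ^ e'); first by apply: (unitsM sV) => //; exact: unitsXz.
by rewrite -!mulrA divff ?mulr1 // expfz_neq0.
Qed.

Lemma ordP h : h != 0 -> exists2 u, units V u & h = u * t ^ (ord V h).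
Proof.
by case: dV => _ _ _ _ dec /dec[e [u uu ->]]; exists u => //; rewrite ord_eq.
Qed.

Lemma ord_unit u : units V u -> ord V u = 0.
Proof. by move=> uu; rewrite -[u]mulr1 -(expr0z t) ord_eq. Qed.

Lemma ordM g h : g != 0 -> h != 0 -> ord V (g * h) = ord V g + ord V h.
Proof.
move=> /ordP[u uu eg] /ordP[v uv eh]; rewrite [in LHS]eg [in LHS]eh mulrACA.
by rewrite -expfzDr // ord_eq //; exact: (unitsM sV).
Qed.

Lemma ordV h : h != 0 -> ord V h^-1 = - ord V h.
Proof.
move=> h0; have := ordM (invr_neq0 h0) h0; rewrite mulVf // ord_unit; [lia|exact: units1].
Qed.

Lemma ordX h n : h != 0 -> ord V (h ^+ n) = n%:Z * ord V h.
Proof.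
move=> h0; elim: n => [|n IH]; first by rewrite expr0 mul0r ord_unit //; exact: units1.
by rewrite exprS ordM ?expf_neq0 // IH; lia.
Qed.

Lemma ord_uniformizer : ord V t = 1.
Proof. by rewrite -[t in ord _ t]mul1r -[t in _ * t]expr1z ord_eq //; exact: units1. Qed.

Lemma ord_prod n (F : 'I_n -> K) (P : pred 'I_n) : (forall i, P i -> F i != 0) ->
  ord V (\prod_(i | P i) F i) = \sum_(i | P i) ord V (F i).
Proof.
move=> F0; pose Q (p : K) (s : int) := p != 0 /\ ord V p = s.
suff [] : Q (\prod_(i | P i) F i) (\sum_(i | P i) ord V (F i)) by [].
apply: (big_ind2 Q).
- by split; [exact: oner_neq0|apply: ord_unit; exact: units1].
- by move=> p s q r [p0 <-] [q0 <-]; split; [exact: mulf_neq0|exact: ordM].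
- by move=> i /F0; split.
Qed.

Lemma ord_ge0 h : h != 0 -> V h <-> 0 <= ord V h.
Proof.
move=> h0; have [u uu eh] := ordP h0; split=> [Vh|].
  apply: dvr_expz_in; rewrite -[_ ^ _](mulKf (units_neq0 uu)) -eh.
  by apply: (subringM sV) => //; case: (unitsV sV uu).
move=> o0; rewrite eh; apply: (subringM sV); first by case: uu.
by move: o0; case: (ord V h) => // n _; exact: (subringX sV).
Qed.

Lemma ord_in h : V h -> h != 0 -> 0 <= ord V h.
Proof. by move=> Vh h0; apply/ord_ge0. Qed.

Lemma ord_div g h : g != 0 -> h != 0 -> V (g / h) <-> ord V h <= ord V g.
Proof.
by move=> g0 h0; rewrite ord_ge0 ?mulf_neq0 ?invr_eq0 // ordM ?invr_eq0 // ordV // subr_ge0.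
Qed.

Lemma ord_gt0 h : h != 0 -> nonunits V h <-> 0 < ord V h.
Proof.
move=> h0; rewrite mt; split=> [/(ideal_gen1P _ sV Vt)[c Vc e]|o].
  have c0 : c != 0 by apply: contraNneq h0 => c0; rewrite e c0 mul0r.
  by rewrite e ordM // ord_uniformizer; have := ord_in Vc c0; lia.
apply/(ideal_gen1P _ sV Vt); exists (h / t); last by rewrite divfK.
by apply/ord_div => //; rewrite ord_uniformizer; lia.
Qed.

Lemma dvr_local : is_local_ring V.
Proof.
split=> //; rewrite mt.
split=> [f /(ideal_gen1P _ sV Vt)[c Vc ->]|||].
- exact: (subringM sV).
- by apply/(ideal_gen1P _ sV Vt); exists 0; rewrite ?mul0r //; exact: (subring0 sV).
- move=> f g /(ideal_gen1P _ sV Vt)[c Vc ->] /(ideal_gen1P _ sV Vt)[c' Vc' ->].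
  apply/(ideal_gen1P _ sV Vt); exists (c + c'); rewrite ?mulrDl //; exact: (subringD sV).
- move=> e f Ve /(ideal_gen1P _ sV Vt)[c Vc ->].
  apply/(ideal_gen1P _ sV Vt); exists (e * c); rewrite ?mulrA //; exact: (subringM sV).
Qed.

Lemma dvr_valuation_ring : is_valuation_ring V.
Proof.
split=> // h h0; have [h1|h1] := lerP 0 (ord V h); first by left; apply/ord_ge0.
by right; apply/ord_ge0; rewrite ?invr_eq0 // ordV // oppr_ge0 ltW.
Qed.

(** A prime containing some nonzero u t^e contains [t], so 0 and the maximal ideal are the only
    primes. *)
Lemma dvr_krull_dim : krull_dim V 1.
Proof.
have lV := dvr_local; have pm := local_prime lV.
have nz P : is_prime_ideal V P -> (exists2 x, P x & x != 0) -> P = nonunits V.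
  move=> pP [h Ph h0]; apply/seteqP; split; first exact: prime_sub_nonunits.
  have Pt : P t.
    have o := ord_in (prime_ideal_sub pP Ph) h0.
    apply: (prime_X (n := `|ord V h|) sV pP Vt).
    have [u uu eh] := ordP h0.
    rewrite exprnP gez0_abs // -[t ^ _](mulKf (units_neq0 uu)) -eh.
    by case: pP => -[_ _ _ PM] _ _; apply: PM => //; case: (unitsV sV uu).
  move=> f; rewrite mt => /(ideal_gen1P _ sV Vt)[c Vc ->].
  by case: pP => -[_ _ _ PM] _ _; exact: PM.
split.
  exists (fun i => if i is 0%N then [set 0] else nonunits V); split.
    case=> [_|i _] //; split.
    - by have [? ? ?] := zero_submodule V; split=> // _ ->; exact: (subring0 sV).
    - by move=> /eqP; rewrite oner_eq0.
    - by move=> x y _ _ /eqP; rewrite mulf_eq0 => /orP[]/eqP ->; [left|right].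
  case=> // _; split; first by move=> _ ->; case: pm => -[].
  by move=> /(_ _ dvr_nonunit) /eqP; rewrite (negbTE t0).
move=> [|[|e]] Q [pQ lQ] //.
have ex i : (i < e.+2)%N -> exists2 x, Q i.+1 x & x != 0.
  move=> lt; have [_ nsub] := lQ i lt; apply: contra_notP nsub => h x Qx.
  case: (eqVneq x 0) => [->|x0]; last by case: h; exists x.
  by case: (pQ i (ltnW lt)) => -[].
have e1 := nz _ (pQ 1%N isT) (ex 0%N isT).
have e2 := nz _ (pQ 2%N isT) (ex 1%N isT).
by have [_ []] := lQ 1%N isT; rewrite e1 e2.
Qed.

Lemma ord_ideal_eq a mu : V mu -> mu != 0 -> ideal_gen V a = ideal_gen V [set mu] ->
  (ord_ideal V a)%:Z = ord V mu.
Proof.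
move=> Vmu mu0 ea; rewrite /ord_ideal; set P := [set _ | _].
have omu := ord_in Vmu mu0.
have principal_eq f g : V f -> V g -> f != 0 -> ideal_gen V [set f] = ideal_gen V [set g] ->
    exists2 c, V c & f = c * g.
  by move=> Vf Vg f0 e; apply/(ideal_gen1P _ sV Vg); rewrite -e => J [_]; apply.
have : P (xget 0%N P).
  apply: xgetPex; exists `|ord V mu|%N; exists t; split=> //.
  rewrite ea; have [u uu emu] := ordP mu0.
  have -> : t ^+ `|ord V mu| = u^-1 * mu.
    by rewrite exprnP gez0_abs // [X in _ * X]emu mulKf //; exact: units_neq0 uu.
  have Vu : V u by case: uu.
  have Vu' : V u^-1 by case: (unitsV sV uu).
  apply/seteqP; split=> f /(ideal_gen1P _ sV).
    move=> /(_ Vmu)[c Vc ->]; apply/(ideal_gen1P _ sV); first exact: (subringM sV).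
    exists (c * u); first exact: (subringM sV).
    by rewrite mulrA mulfK //; exact: units_neq0 uu.
  move=> /(_ (subringM sV Vu' Vmu))[c Vc ->]; apply/(ideal_gen1P _ sV Vmu).
  by exists (c * u^-1); [exact: (subringM sV)|rewrite mulrA].
move: (xget 0%N P) => e [t' [mt' ]]; rewrite ea => h.
have [v uv et'] := uniformizer_unit mt'.
have t'0 : t' != 0 by rewrite et' mulf_neq0 // (units_neq0 uv).
have Vt' : V t' by rewrite et'; apply: (subringM sV) => //; case: uv.
have ot' : ord V t' = 1 by rewrite et' -[t in _ * t]expr1z ord_eq.
have Vt'e := subringX sV e Vt'.
have [c Vc ec] := principal_eq _ _ Vmu Vt'e mu0 h.
have t'e0 : t' ^+ e != 0 by rewrite expf_neq0.
have [c' Vc' ec'] := principal_eq _ _ Vt'e Vmu t'e0 (esym h).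
have c0 : c != 0 by apply: contraNneq mu0 => c0; rewrite ec c0 mul0r.
have c'0 : c' != 0 by apply: contraNneq t'e0 => c'0; rewrite ec' c'0 mul0r.
have o1 : ord V mu = ord V c + e%:Z by rewrite [in LHS]ec ordM // ordX // ot'; lia.
have o2 : e%:Z = ord V c' + ord V mu.
  by rewrite -[LHS]mulr1 -ot' -ordX // [in LHS]ec' ordM.
by have := ord_in Vc c0; have := ord_in Vc' c'0; lia.
Qed.

Lemma ord_ideal_min a : a `<=` V -> (exists2 f, a f & f != 0) ->
  exists f, [/\ a f, f != 0, (ord_ideal V a)%:Z = ord V f
    & forall g, a g -> g != 0 -> ord V f <= ord V g].
Proof.
move=> aV [f af f0].
have exn : exists n, `[< exists g, [/\ a g, g != 0 & ord V g = n%:Z] >].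
  exists `|ord V f|%N; apply/asboolP; exists f; split=> //.
  by rewrite gez0_abs //; apply: ord_in => //; exact: aV.
case: (ex_minnP exn) => n /asboolP[g [ag g0 og]] min.
have gmin h : a h -> h != 0 -> ord V g <= ord V h.
  move=> ah h0; have oh : 0 <= ord V h by apply: ord_in => //; exact: aV.
  have /min : `[< exists g, [/\ a g, g != 0 & ord V g = `|ord V h|%N%:Z] >].
    by apply/asboolP; exists h; split=> //; rewrite gez0_abs.
  by rewrite og; lia.
exists g; split=> //; apply: ord_ideal_eq => //; first exact: aV.
have ag' : [set g] `<=` V by move=> _ ->; exact: aV.
apply/seteqP; split; apply: smallest_sub; try exact: ideal_gen_ideal.
  move=> h ah; apply/(ideal_gen1P _ sV (aV _ ag)).
  case: (eqVneq h 0) => [->|h0]; first by exists 0; rewrite ?mul0r //; exact: (subring0 sV).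
  by exists (h / g); [apply/ord_div => //; exact: gmin|rewrite divfK].
by move=> _ -> J [_]; apply.
Qed.
End Order.
End DiscreteValuationRings.

(** * Local rings of models *)

Section Localization.
Variables (K : fieldType) (B Q : set K).
Hypotheses (sB : subring_set B) (pQ : is_prime_ideal B Q).
Local Notation S := (localization B Q).

Lemma notin_prime_neq0 s : ~ Q s -> s != 0.
Proof. by apply: contra_notN => /eqP ->; case: pQ => -[]. Qed.

Lemma notin_primeM s s' : B s -> B s' -> ~ Q s -> ~ Q s' -> ~ Q (s * s').
Proof. by move=> Bs Bs' ns ns'; case: pQ => _ _ /(_ _ _ Bs Bs') + h => /(_ h)[]. Qed.

Lemma notin_prime1 : ~ Q 1.
Proof. by case: pQ. Qed.

Lemma sub_localization : B `<=` S.
Proof.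
move=> x Bx; exists x, 1; rewrite divr1; split=> //; [exact: (subring1 sB)|exact: notin_prime1].
Qed.

Lemma localization_subring : subring_set S.
Proof.
apply/subring_setP; split.
- exact/sub_localization/(subring1 sB).
- move=> _ _ [a [s [Ba Bs ns ->]]] [a' [s' [Ba' Bs' ns' ->]]].
  exists (a * s' - a' * s), (s * s'); split.
  + by apply: (subringB sB); exact: (subringM sB).
  + exact: (subringM sB).
  + exact: notin_primeM.
  + by have s0 := notin_prime_neq0 ns; have s'0 := notin_prime_neq0 ns'; field; rewrite ?s0 ?s'0.
- move=> _ _ [a [s [Ba Bs ns ->]]] [a' [s' [Ba' Bs' ns' ->]]].
  exists (a * a'), (s * s'); split; [exact: (subringM sB)|exact: (subringM sB)|exact: notin_primeM|].
  by rewrite invfM mulrACA.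
Qed.

Lemma localization_unit s : B s -> ~ Q s -> units S s.
Proof.
move=> Bs ns; apply/(unitsE _ localization_subring); split.
- exact: sub_localization.
- exact: notin_prime_neq0.
- by exists 1, s; rewrite div1r; split=> //; exact: (subring1 sB).
Qed.

Lemma localization_nonunit a s : B a -> B s -> ~ Q s -> nonunits S (a / s) <-> Q a.
Proof.
move=> Ba Bs ns; have s0 := notin_prime_neq0 ns; have sS := localization_subring.
have [_ nQ1 _] := pQ; split=> [[_ nu]|Qa].
  apply: contrapT => nQa; apply: nu; apply: (unitsM sS); first exact: localization_unit.
  by apply/(unitsV sS)/localization_unit.
split; first by exists a, s.
case=> _ [_ [b [s' [Bb Bs' ns' ->]]] e]; have s'0 := notin_prime_neq0 ns'.
have e' : b * a = s * s'.
  have -> : b * a = (a / s * (b / s')) * (s * s') by field; rewrite ?s0 ?s'0.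
  by rewrite e mul1r.
apply: (notin_primeM Bs Bs' ns ns'); rewrite -e'.
by case: pQ => -[_ _ _ QM] _ _; exact: QM.
Qed.

Lemma localization_ess_generated (k : closedFieldType) (iota : {rmorphism k -> K}) s :
  range iota `<=` B -> [set` s] `<=` B ->
  (forall A, subring_set A -> range iota `<=` A -> [set` s] `<=` A ->
    (forall x, A x -> units S x -> A x^-1) -> B `<=` A) ->
  ess_generated iota S s.
Proof.
move=> cB ss gen; split; try exact: (subset_trans _ sub_localization).
move=> A sA cA sAs AV; have BA := gen A sA cA sAs AV.
move=> _ [a [b [Ba Bb nb ->]]]; apply: (subringM sA); first exact: BA.
by apply: AV; [exact: BA|exact: localization_unit].
Qed.

Lemma localization_localization p : is_prime_ideal S p ->
  is_prime_ideal B (B `&` p) /\ localization S p = localization B (B `&` p).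
Proof.
move=> pp; have [[pS p0 pD pM] p1 pP] := pp.
have BS := sub_localization; split.
  split.
  - split=> [x []//||x y [Bx px] [By py]|c x Bc [Bx px]].
    + by split; [exact: (subring0 sB)|].
    + by split; [exact: (subringD sB)|exact: pD].
    + by split; [exact: (subringM sB)|apply: pM => //; exact: BS].
  - by case.
  - by move=> x y Bx By [_ /pP[||px|py]]; [exact: BS|exact: BS|left|right].
apply/seteqP; split=> f.
  move=> [_ [_ [[a [s [Ba Bs ns ->]]] [b [s' [Bb Bs' ns' ->]]] nv ->]]].
  have s0 := notin_prime_neq0 ns; have s'0 := notin_prime_neq0 ns'.
  have b0 : b != 0 by apply: contra_not_neq nv => ->; rewrite mul0r.
  exists (a * s'), (b * s); split; [exact: (subringM sB)|exact: (subringM sB)| |].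
    move=> [_ pbs]; apply: nv; rewrite (_ : b / s' = (s^-1 / s') * (b * s)); last by field; rewrite ?s0 ?s'0.
    apply: pM => //; exists 1, (s * s').
    by split; [exact: (subring1 sB)|exact: (subringM sB)|exact: notin_primeM|rewrite div1r invfM].
  by field; rewrite ?s0 ?s'0 ?b0.
move=> [a [b [Ba Bb nb ->]]]; exists a, b; split=> //; [exact: BS|exact: BS|].
by move=> pb; apply: nb.
Qed.
End Localization.

(** * Points of models, bases of derivations and the relative canonical divisor *)

Section Models.
Variables (k : closedFieldType) (K : fieldType) (iota : {rmorphism k -> K}).
Hypothesis k0 : [pchar k] =i pred0.
Implicit Types (R S V : set K).

(** Regularity itself is supplied alongside, by [regular_parameters] or [is_regular_local_ring]. *)
Definition regular_model S : Prop :=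
  [/\ is_local_ring S, is_noetherian S, has_fraction_field_K S
    & exists s, ess_generated iota S s].

Lemma fraction_field_mono S V : S `<=` V -> has_fraction_field_K S -> has_fraction_field_K V.
Proof.
by move=> SV fS x; have [a [b [Sa Sb b0 ->]]] := fS x; exists a, b; split=> //; exact: SV.
Qed.

Lemma regular_model_coords S d (x : 'I_d -> K) : regular_model S -> regular_parameters S x ->
  exists n (f : 'I_d -> 'I_n) w D,
    [/\ injective f, coords iota S w D & forall i, w (f i) = x i].
Proof.
move=> [lS _ fS [s gS]] rx.
have [r [w [D [cw wx]]]] := exists_coords k0 lS gS fS rx.
by exists (d + r)%N, (lshift r), w, D; split=> //; exact: lshift_inj.
Qed.

Lemma smallest_subring (X : set K) : subring_set (smallest (@is_subring K) X).
Proof.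
apply/subring_setP; split.
- by move=> A [/subring_setP[]].
- move=> x y hx hy A hA; have /subring_setP[_ AB _] := proj1 hA.
  by apply: AB; [exact: hx|exact: hy].
- move=> x y hx hy A hA; have /subring_setP[_ _ AM] := proj1 hA.
  by apply: AM; [exact: hx|exact: hy].
Qed.

Lemma smooth_regular R : local_ring_of_smooth_variety iota R ->
  regular_model R /\ exists d (x : 'I_d -> K), regular_parameters R x.
Proof.
move=> [A [P [[s eA] fA reg pP ->]]].
have sA : subring_set A by rewrite eA; exact: smallest_subring.
have [|lR nR rx] := reg (localization A P); first by exists P.
split=> //; split=> //; first exact: (fraction_field_mono (sub_localization sA pP)).
exists s; apply: localization_ess_generated => //.
- by rewrite eA => x cx B [_]; apply; left.
- by rewrite eA => x cx B [_]; apply; right.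
- move=> B sB cB sBs _; rewrite eA; apply: smallest_sub => //.
  by move=> x []; [exact: cB|exact: sBs].
Qed.

Section Points.
Variables (R : set K) (M : set (set K)).
Hypotheses (mR : regular_model R) (pM : proper_birational R M).

Lemma point_localization S : M S -> exists B Q,
  [/\ subring_set B, R `<=` B, is_prime_ideal B Q, S = localization B Q &
   (exists s : seq K, B = smallest (@is_subring K) (R `|` [set` s])) /\ Spec B `<=` M].
Proof.
case: pM => -[N [A [ftA ->]]] _ [i _ [Q pQ ->]].
have [s eA] := ftA i; exists (A i), Q; split=> //.
- by rewrite eA; exact: smallest_subring.
- by rewrite eA => x Rx B [_]; apply; left.
- by split; [exists s|move=> T hT; exists i].
Qed.

Lemma point_sub S : M S -> R `<=` S.
Proof.
by move=> /point_localization[B [Q [sB RB pQ -> _]]]; apply: subset_trans (sub_localization sB pQ).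
Qed.

Lemma point_regular_model S : M S -> is_regular_local_ring S -> regular_model S.
Proof.
move=> MS [lS nS _]; split=> //.
  by apply: fraction_field_mono (point_sub MS) _; case: mR.
have [B [Q [sB RB pQ eS [[s eB] _]]]] := point_localization MS.
have [_ _ _ [s' [ss' cR gR]]] := mR.
exists (s' ++ s); rewrite eS; apply: localization_ess_generated => //.
- exact: subset_trans RB.
- move=> x /=; rewrite mem_cat => /orP[xs|xs]; first exact/RB/ss'.
  by rewrite eB => A [_]; apply; right.
- move=> A sA cA sAs AV; have RA : R `<=` A.
    apply: gR => //; first by move=> x /= xs; apply: sAs; rewrite /= mem_cat xs.
    move=> x Ax [Rx [y Ry xy]]; apply: AV => //.
    have RS : R `<=` localization B Q by rewrite -eS; exact: point_sub.
    by split; [exact: RS|exists y => //; exact: RS].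
  rewrite eB; apply: smallest_sub => // x []; first exact: RA.
  by move=> /= xs; apply: sAs; rewrite /= mem_cat xs orbT.
Qed.

(** This makes the parameter divisors through a center prime divisors of the log resolution
    itself. *)
Lemma point_generization S p : M S -> is_prime_ideal S p -> M (localization S p).
Proof.
move=> /point_localization[B [Q [sB _ pQ -> [_ SM]]]] pp.
have [pB ->] := localization_localization sB pQ pp.
by apply: SM; exists (B `&` p).
Qed.
End Points.

Lemma coords_basis S n (w : 'I_n -> K) D : coords iota S w D -> derivation_basis iota S D.
Proof.
move=> [Sw dD Dw gen]; split=> // E [dE ES].
exists (\row_i E (w i)); split.
  split=> [i|x]; first by rewrite mxE; exact/ES/Sw.
  by rewrite gen //; apply: eq_bigr => i _; rewrite mxE.
move=> c [_ Ec]; apply/rowP => j; rewrite mxE Ec (bigD1 j) //= Dw eqxx mulr1.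
by rewrite big1 ?addr0 // => i ij; rewrite Dw (negbTE ij) mulr0.
Qed.

Lemma basis_coords S n (w : 'I_n -> K) D m (F : 'I_m -> K -> K) :
  subring_set S -> coords iota S w D -> derivation_basis iota S F ->
  exists (A : 'M[K]_(n, m)) (B : 'M[K]_(m, n)),
  [/\ forall i j, S (A i j), forall i j, S (B i j), A *m B = 1%:M, B *m A = 1%:M
   & forall i j, B i j = F i (w j)].
Proof.
move=> sS [Sw dD Dw gen] [dF genF].
have /choice[a aP] : forall i, exists c : 'rV[K]_m,
    (forall j, S (c 0 j)) /\ forall x, D i x = \sum_j c 0 j * F j x.
  by move=> i; have [c [hc _]] := genF _ (dD i); exists c.
pose A := \matrix_(i, j) a i 0 j; pose B := \matrix_(i, j) F i (w j).
have AB : A *m B = 1%:M.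
  apply/matrixP => i j; rewrite !mxE -Dw (proj2 (aP i)).
  by apply: eq_bigr => l _; rewrite !mxE.
exists A, B; split=> //.
- by move=> i j; rewrite mxE; exact: (proj1 (aP i)).
- by move=> i j; rewrite mxE; case: (dF i) => _; apply; exact: Sw.
(* Rows of [B *m A] and of the identity both expand [F i] in the basis [F], and the expansion is
   unique. *)
- apply/row_matrixP => i; have [c [_ uc]] := genF _ (dF i).
  rewrite -(uc (row i (B *m A))); first rewrite -(uc (row i 1%:M)) //.
    split=> [j|x]; first by rewrite !mxE; exact: (subring_nat sS).
    rewrite (bigD1 i) //= !mxE eqxx mul1r big1 ?addr0 // => j ji.
    by rewrite !mxE eq_sym (negbTE ji) mul0r.
  split=> [j|x].
    rewrite !mxE; apply: (subring_sum sS) => l _; rewrite !mxE; apply: (subringM sS).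
      by case: (dF i) => _; apply; exact: Sw.
    exact: (proj1 (aP l)).
  rewrite (gen (F i)); last by case: (dF i).
  under eq_bigr => l _ do rewrite (proj2 (aP l)) mulr_sumr.
  rewrite exchange_big; apply: eq_bigr => j _ /=; rewrite !mxE mulr_suml.
  by apply: eq_bigr => l _; rewrite !mxE mulrA.
- by move=> i j; rewrite mxE.
Qed.

Lemma mx_inv_dim n m (A : 'M[K]_(n, m)) (B : 'M[K]_(m, n)) :
  A *m B = 1%:M -> B *m A = 1%:M -> n = m.
Proof.
move=> e e'; apply/eqP; rewrite eqn_leq; apply/andP; split.
  by rewrite -(mxrank1 K n) -e (leq_trans (mxrankM_maxr _ _)) ?rank_leq_row.
by rewrite -(mxrank1 K m) -e' (leq_trans (mxrankM_maxr _ _)) ?rank_leq_row.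
Qed.

Lemma units_sub S V x : S `<=` V -> units S x -> units V x.
Proof. by move=> SV [Sx [y Sy xy]]; split; [exact: SV|exists y => //; exact: SV]. Qed.

Lemma jacobian_neq0 S S' n (w : 'I_n -> K) D (w' : 'I_n -> K) D' :
  coords iota S w D -> coords iota S' w' D' -> \det (jacobian w D') != 0.
Proof.
move=> c c'; have := jacobian_comp c' c c'; rewrite (jacobian_id c') => /(congr1 determinant).
rewrite det_mulmx det1 => e; apply: contra_eq_neq e => ->; rewrite mul0r.
exact: oner_neq0.
Qed.

(** The bases picked by [xget] differ from the coordinate ones by invertible matrices over [R] and
    over [V]; their determinants are units of [V] and do not change the order. *)
Theorem rel_canonical_eq R V t n (w : 'I_n -> K) D (w' : 'I_n -> K) D' :
  subring_set R -> R `<=` V -> dvr V t -> coords iota R w D -> coords iota V w' D' ->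
  rel_canonical_coef iota R V = ord V (\det (jacobian w D')).
Proof.
move=> sR RV dV cw cw'; have [sV _ _ _ _] := dV.
rewrite /rel_canonical_coef; set P := [set _ | _].
have : P (xget 0 P).
  apply: xgetPex; exists (ord V (\det (jacobian w D'))), n, D, D', (jacobian w D').
  split=> //; [exact: coords_basis cw|exact: coords_basis cw'|].
  by move=> i x; exact: (jacobianP cw cw').
move: (xget 0 P) => g [m [F [G [C [bF bG GC ->]]]]].
have [A [B [RA RB AB BA eB]]] := basis_coords sR cw bF.
have [A' [B' [VA' VB' AB' BA' eB']]] := basis_coords sV cw' bG.
have nm := mx_inv_dim AB BA; subst m.
have e : C *m B = B' *m jacobian w D'.
  apply/matrixP => i j; rewrite !mxE.
  transitivity (G i (w j)).
    by rewrite GC; apply: eq_bigr => l _; rewrite eB.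
  have [_ _ _ gen] := cw'; rewrite gen; last by case: bG => /(_ i)[].
  by apply: eq_bigr => l _; rewrite eB' mxE.
have J0 := jacobian_neq0 cw cw'.
have uB : units V (\det B) by apply/(units_sub RV)/(det_units sR RB RA BA).
have uB' : units V (\det B') by exact: (det_units sV VB' VA' BA').
have := congr1 determinant e; rewrite !det_mulmx => e'.
have C0 : \det C != 0.
  apply: contra_eq_neq e' => ->; rewrite mul0r eq_sym mulf_neq0 //.
  exact: units_neq0 uB'.
have := congr1 (ord V) e'; rewrite !(ordM dV) ?(units_neq0 uB) ?(units_neq0 uB') //.
by rewrite (ord_unit dV uB) (ord_unit dV uB') addr0 add0r.
Qed.

End Models.

(** * Log discrepancies *)

Section Discrepancies.
Variables (k : closedFieldType) (K : fieldType) (iota : {rmorphism k -> K}).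
Hypothesis k0 : [pchar k] =i pred0.
Implicit Types (R S V : set K) (M N : set (set K)) (h t : K).

(** The logarithmic derivative turns products into sums, so it suffices to treat units of [V] and
    [t]. *)
Lemma logarithmic_derivative V t E s h : dvr V t -> derivation_of iota V E ->
  V s -> V (s * E t / t) -> h != 0 -> V (s * E h / h).
Proof.
move=> dV [dE EV] Vs st; have [sV t0 Vt _ _] := dV.
have unit_case u : units V u -> V (s * E u / u).
  move=> uu; apply: (subringM sV); last by case: (unitsV sV uu).
  by apply: (subringM sV) => //; apply: EV; case: uu.
have LM (f g : K) : f != 0 -> g != 0 -> s * E (f * g) / (f * g) = s * E f / f + s * E g / g.
  by move=> f0 g0; rewrite (derM dE); field; rewrite ?f0 ?g0.
have LX n : V (s * E (t ^+ n) / t ^+ n).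
  elim: n => [|n IH]; first by rewrite expr0 (der1 dE) mulr0 mul0r; exact: (subring0 sV).
  by rewrite exprS LM ?expf_neq0 //; exact: (subringD sV).
move=> h0; have [u uu ->] := ordP dV h0; have u0 := units_neq0 uu.
have te0 : t ^ (ord V h) != 0 by rewrite expfz_neq0.
rewrite LM //; apply: (subringD sV); first exact: unit_case.
case: (ord V h) => n; first exact: LX.
rewrite NegzE -invr_expz (derV dE) ?expf_neq0 //.
rewrite [s * _ / _](_ : _ = - (s * E (t ^+ n.+1) / t ^+ n.+1)); first exact: (subringN sV).
have tn0 : t ^+ n.+1 != 0 by rewrite expf_neq0.
by rewrite -exprnP in tn0 *; move: (t ^+ n.+1) tn0 => y y0; field; rewrite y0 oner_neq0.
Qed.

(* The forms dx_a / x_a have at most a logarithmic pole along V; J' is the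
   jacobian matrix in logarithmic bases. *)
Lemma ord_jacobian_ge V t n (w' : 'I_n -> K) D' i0 S (w : 'I_n -> K) D d
    (f : 'I_d -> 'I_n) (x : 'I_d -> K) :
  dvr V t -> coords iota V w' D' -> w' i0 = t -> coords iota S w D -> S `<=` V ->
  injective f -> (forall i, w (f i) = x i) -> (forall i, x i != 0) ->
  \sum_i ord V (x i) <= ord V (\det (jacobian w D')) + 1.
Proof.
move=> dV cw' wt cw SV injf wx x0; have [sV t0 Vt _ _] := dV.
have [Vw' dD' Dw' _] := cw'; have [Sw _ _ _] := cw.
(* The factor [s] replaces the derivation along [t] by t d/dt, and [c] replaces dx_a by dx_a / x_a.
   The determinant of [J'] is then det * t / \prod_a x_a, whence the 1 in the bound. *)
pose s i := if i == i0 then t else 1.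
pose c j := \prod_(a | f a == j) x a.
have Vs i : V (s i) by rewrite /s; case: eqP => // _; exact: (subring1 sV).
have c0 j : c j != 0 by apply/prodf_neq0.
have hs i : V (s i * D' i t / t).
  rewrite -{1}wt Dw' /s; case: eqP => _.
    by rewrite mulr1 divff //; exact: (subring1 sV).
  by rewrite mulr0 mul0r; exact: (subring0 sV).
pose J' : 'M[K]_n := \matrix_(i, j) (s i * D' i (w j) / c j).
have VJ' i j : V (J' i j).
  rewrite mxE; case: (pickP (fun a => f a == j)) => [a /eqP fa|none].
    have -> : c j = x a.
      rewrite /c (bigD1 a) ?fa //= big1 ?mulr1 // => b /andP[/eqP fb].
      by rewrite -fa in fb; rewrite (injf _ _ fb) eqxx.
    by rewrite -fa wx; apply: (logarithmic_derivative dV).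
  rewrite /c big_pred0 // divr1; apply: (subringM sV) => //.
  by case: (dD' i) => _; apply; exact/SV/Sw.
have eJ : J' = diag_mx (\row_i s i) *m jacobian w D' *m diag_mx (\row_j (c j)^-1).
  apply/matrixP => i j; rewrite mul_mx_diag !mxE; congr (_ / _).
  rewrite (bigD1 i) //= !mxE eqxx mulr1n big1 ?addr0 // => l li.
  by rewrite !mxE eq_sym (negbTE li) mulr0n mul0r.
have es : \prod_i (\row_i s i) 0 i = t.
  rewrite (bigD1 i0) //= mxE /s eqxx big1 ?mulr1 // => i /negbTE ni.
  by rewrite mxE ni.
have ec : \prod_i (\row_j (c j)^-1) 0 i = (\prod_a x a)^-1.
  rewrite [\prod_a x a](partition_big f predT) //= -prodfV.
  by apply: eq_bigr => i _; rewrite mxE.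
have detJ := congr1 determinant eJ; rewrite !det_mulmx !det_diag es ec in detJ.
have J0 := jacobian_neq0 cw cw'.
have p0 : \prod_a x a != 0 by apply/prodf_neq0.
have dJ'0 : \det J' != 0 by rewrite detJ !mulf_neq0 ?invr_eq0.
have := ord_in dV (det_in sV VJ') dJ'0.
rewrite detJ !(ordM dV) ?mulf_neq0 ?invr_eq0 // (ordV dV) // (ord_uniformizer dV).
rewrite (ord_prod dV) //. rewrite subr_ge0 addrC; apply.
Qed.

(** * Prime divisors cut out by regular parameters *)

Section ParameterDivisors.
Variables (S : set K) (d : nat) (x : 'I_d -> K) (n : nat) (f : 'I_d -> 'I_n).
Variables (w : 'I_n -> K) (D : 'I_n -> K -> K).
Hypotheses (mS : regular_model iota S) (rx : regular_parameters S x).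
Hypotheses (injf : injective f) (cw : coords iota S w D) (wx : forall i, w (f i) = x i).

Let lS : is_local_ring S. Proof. by case: mS. Qed.
Let sS : subring_set S. Proof. by case: lS. Qed.
Let nS : is_noetherian S. Proof. by case: mS. Qed.
Let kS : range iota `<=` S. Proof. by case: mS => _ _ _ [s []]. Qed.
Let mx : nonunits S = ideal_gen S (range x). Proof. by case: rx. Qed.
Let dD i : derivation_of iota S (D (f i)). Proof. by case: cw. Qed.
Let Dx i j : D (f i) (x j) = (i == j)%:R.
Proof. by case: cw => _ _ h _; rewrite -wx h (inj_eq injf). Qed.

Definition param_divisor i := localization S (principal S (x i)).

Lemma param_divisor_prime i : is_prime_ideal S (principal S (x i)).
Proof. exact: (param_prime k0 lS nS kS mx dD Dx). Qed.

Lemma params_neq0 i : x i != 0.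
Proof. exact: (param_neq0 dD Dx). Qed.

Lemma params_in i : S (x i).
Proof. by case: (param_nonunit mx i). Qed.

Lemma sub_param_divisor i : S `<=` param_divisor i.
Proof. exact: (sub_localization sS (param_divisor_prime i)). Qed.

Lemma param_divisor_dvr i : is_local_ring (param_divisor i) ->
  is_noetherian (param_divisor i) -> dvr (param_divisor i) (x i).
Proof.
move=> lL nL; have pp := param_divisor_prime i.
apply: dvr_of_noetherian => //; last exact: params_neq0.
  by apply: fraction_field_mono (@sub_param_divisor i) _; case: mS.
have sL := localization_subring sS pp.
have Lx : param_divisor i (x i) by apply/sub_param_divisor/params_in.
apply/seteqP; split=> h.
  move=> nh; have [[a [s [Sa Ss ns eh]]] _] := nh.
  move: nh; rewrite eh => /(localization_nonunit sS pp Sa Ss ns)[c Sc ->].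
  apply/(ideal_gen1P _ sL Lx); exists (c / s); last by rewrite -mulrA mulrC.
  by exists c, s.
move=> /(ideal_gen1P _ sL Lx)[_ [c [s [Sc Ss ns ->]]] ->].
rewrite mulrAC; apply/(localization_nonunit sS pp) => //.
  by apply: (subringM sS) => //; exact: params_in.
by exists c => //; rewrite mulrC.
Qed.

Lemma param_divisor_coords i : coords iota (param_divisor i) w D.
Proof.
have [Sw dD' Dw gen] := cw; have pp := param_divisor_prime i; split=> //.
- by move=> j; apply: sub_param_divisor.
- move=> j; split; first by case: (dD' j).
  move=> _ [a [s [Sa Ss ns ->]]].
  apply: (der_ratio_in (proj1 (dD' j)) (localization_subring sS pp)
    (@sub_param_divisor i) Sa Ss).
    by case: (unitsV (localization_subring sS pp) (localization_unit sS pp Ss ns)).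
  by move=> y Sy; apply: sub_param_divisor; case: (dD' j) => _; apply.
Qed.

Hypothesis rL : forall i, is_local_ring (param_divisor i) /\ is_noetherian (param_divisor i).

Let dL i : dvr (param_divisor i) (x i).
Proof. by apply: param_divisor_dvr; case: (rL i). Qed.

(** Divisibility descends from the localization to [S] because (x_i) is prime: an element of [S]
    that is a nonunit at its generic point is a multiple of x_i. *)
Lemma param_divisor_dvd i g (m : nat) : S g -> g != 0 -> m%:Z <= ord (param_divisor i) g ->
  exists2 h, S h & g = x i ^+ m * h.
Proof.
move=> Sg g0; have pp := param_divisor_prime i.
elim: m => [|m IH] le; first by exists g; rewrite ?mul1r.
have [|h Sh eg] := IH; first by lia.
have h0 : h != 0 by apply: contraNneq g0 => h0; rewrite eg h0 mulr0.
have xm0 : x i ^+ m != 0 by rewrite expf_neq0 // params_neq0.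
have : nonunits (param_divisor i) h.
  apply/(ord_gt0 (dL i) h0); move: le; rewrite eg (ordM (dL i)) // (ordX (dL i)) ?params_neq0 //.
  by rewrite (ord_uniformizer (dL i)); lia.
have nS1 : ~ principal S (x i) 1 by case: pp.
rewrite -[h]divr1 => /(localization_nonunit sS pp Sh (subring1 sS) nS1)[c Sc eh].
by exists c => //; rewrite eg eh exprSr mulrA.
Qed.

Lemma ord_param_divisor_other i j : i != j -> ord (param_divisor j) (x i) = 0.
Proof.
move=> ij; apply: (ord_unit (dL j)).
apply: (localization_unit sS (param_divisor_prime j) (params_in i)).
exact: (param_coprime mx dD Dx ij).
Qed.

(** One parameter is divided out at a time; the others are units along its divisor, so the order of
    the cofactor is not lowered. *)
Lemma param_divisors_dvd g (m : 'I_d -> nat) : S g -> g != 0 ->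
  (forall i, (m i)%:Z <= ord (param_divisor i) g) ->
  exists2 h, S h & g = (\prod_i x i ^+ m i) * h.
Proof.
move=> Sg g0 le.
suff H : forall l : seq 'I_d, uniq l -> exists2 h, S h & g = (\prod_(i <- l) x i ^+ m i) * h.
  by apply: H; exact: index_enum_uniq.
elim=> [_|i l IH /= /andP[il ul]]; first by exists g; rewrite ?big_nil ?mul1r.
have [h Sh eg] := IH ul.
have xm0 j : x j ^+ m j != 0 by rewrite expf_neq0 // params_neq0.
have p0 : \prod_(j <- l) x j ^+ m j != 0 by rewrite prodf_seq_neq0; apply/allP => j _ /=; rewrite xm0.
have h0 : h != 0 by apply: contraNneq g0 => h0; rewrite eg h0 mulr0.
have op : ord (param_divisor i) (\prod_(j <- l) x j ^+ m j) = 0.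
  elim: l il p0 {IH ul eg} => [_ _|j l IHl].
    by rewrite big_nil (ord_unit (dL i)) //; apply: units1; case: (dL i).
  rewrite inE negb_or eq_sym => /andP[ji il]; rewrite big_cons mulf_eq0 negb_or => /andP[_ p0].
  by rewrite (ordM (dL i)) // IHl // (ordX (dL i)) ?params_neq0 // ord_param_divisor_other // mulr0.
have [|h' Sh' eh] := @param_divisor_dvd i h (m i) Sh h0.
  by move: (le i); rewrite eg (ordM (dL i)) // op add0r.
by exists h' => //; rewrite big_cons eg {1}eh; ring.
Qed.
End ParameterDivisors.

(** No model is attached to [V], so that all the ideals share one index set of valuations. *)
Definition divisorial R V : Prop :=
  [/\ R `<=` V, regular_model iota V, is_regular_local_ring V & krull_dim V 1].

Lemma divisorial_coords R V : divisorial R V -> exists t, dvr V t /\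
  exists n (i0 : 'I_n) w D, coords iota V w D /\ w i0 = t.
Proof.
move=> [RV mV [lV nV [d [x rx]]] [[Q chQ] dimV]].
have d1 : d = 1%N.
  case: rx => -[[Q' chQ'] dimd] _; apply/eqP; rewrite eqn_leq.
  by rewrite (dimV _ _ chQ') (dimd _ _ chQ).
subst d; have [n [f [w [D [_ cw wx]]]]] := regular_model_coords k0 mV rx.
have [sV _] := lV; have [_ mx] := rx.
have ex : range x = [set x ord0].
  by apply/seteqP; split=> [_ [i _ <-]|_ ->]; [rewrite (ord1 i)|exists ord0].
rewrite ex in mx.
have t0 : x ord0 != 0.
  have [pQ lQ] := chQ; have [_ nsub] := lQ 0%N isT.
  apply/eqP => x0; apply: nsub => y /(prime_sub_nonunits (pQ 1%N isT)).
  rewrite mx x0 => /(ideal_gen1P _ sV (subring0 sV))[c _ ->]; rewrite mulr0.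
  by case: (pQ 0%N isT) => -[].
exists (x ord0); split; last by exists n, (f ord0), w, D.
by apply: dvr_of_noetherian => //; case: mV.
Qed.

(** * Comparison of divisors over X and the valuative formula for lc *)

Section OverR.
Variables (R : set K) (dR : nat) (xR : 'I_dR -> K).
Hypotheses (mR : regular_model iota R) (rR : regular_parameters R xR).

Let sR : subring_set R. Proof. by case: mR => -[]. Qed.

Lemma prime_divisor_divisorial a M V : log_resolution R a M -> prime_divisor M V ->
  divisorial R V.
Proof.
move=> [pM regM _] [MV dimV]; have rV := regM _ MV; split=> //.
  exact: (point_sub pM).
exact: (point_regular_model mR pM).
Qed.

Lemma rel_canonical_ge0 V : divisorial R V -> 0 <= rel_canonical_coef iota R V.
Proof.
move=> dV; have [t [dvrV [n [i0 [w' [D' [cw' _]]]]]]] := divisorial_coords dV.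
have [nR [fR [w [D [_ cw _]]]]] := regular_model_coords k0 mR rR.
have e := coords_dim cw cw'; subst nR.
have [RV _ _ _] := dV; have [sV _ _ _ _] := dvrV.
rewrite (rel_canonical_eq sR RV dvrV cw cw'); apply: (ord_in dvrV).
  apply: det_in => // i j; apply: (jacobian_in cw RV) => l y Vy.
  exact: (coords_der_in cw' l Vy).
exact: jacobian_neq0 cw cw'.
Qed.

(** With g the determinant of df along V, the operator g t D_i sends h into h V. So each derivative
    lowers the order by at most ord(g) + 1, and [param_order] reaches a unit, of order 0, after
    [size l] of them. *)
Lemma order_bound f : R f -> f != 0 -> exists e : nat, forall V, divisorial R V ->
  ord V f <= e%:Z * (rel_canonical_coef iota R V + 1).
Proof.
move=> Rf f0.
have [nR [fR [w [D [injf cw wx]]]]] := regular_model_coords k0 mR rR.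
have [lR nRo _ [s [_ kR _]]] := mR; have [_ mx] := rR; have [Rw dD Dw _] := cw.
have Dx i j : D (fR i) (xR j) = (i == j)%:R by rewrite -wx Dw (inj_eq injf).
have [l ul] := param_order k0 lR nRo kR mx (fun i => dD (fR i)) Dx Rf f0.
exists (size l) => V dV.
have [t [dvrV [n [i0 [w' [D' [cw' _]]]]]]] := divisorial_coords dV.
have e := coords_dim cw cw'; subst nR.
have [RV _ _ _] := dV; have [sV t0 Vt _ _] := dvrV.
rewrite (rel_canonical_eq sR RV dvrV cw cw').
set P := jacobian w D'; set g := \det P.
have g0 : g != 0 by exact: jacobian_neq0 cw cw'.
have VP i j : V (P i j).
  by apply: (jacobian_in cw RV) => m y Vy; exact: (coords_der_in cw' m Vy).
have Vg : V g by exact: det_in.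
have PQ : P *m jacobian w' D = 1%:M.
  by rewrite -(jacobian_comp cw' cw cw') (jacobian_id cw').
(* Cramer's rule: g times the inverse of [P] is its adjugate, with entries in [V]. *)
have gQ i j : V (g * jacobian w' D i j).
  have : g *: jacobian w' D = \adj P.
    by rewrite -mul_scalar_mx /g -mul_adj_mx -mulmxA PQ mulmx1.
  move=> /matrixP/(_ i j); rewrite mxE => ->; rewrite mxE.
  apply: (subringM sV); first by apply: (subringX sV); apply/(subringN sV)/(subring1 sV).
  by apply: det_in => // ? ?; rewrite !mxE; apply: (coords_der_in cw'); exact: RV.
have step i h : h != 0 -> V (g * t * D i h / h).
  move=> h0; rewrite (jacobianP cw' cw) mulr_sumr mulr_suml.
  apply: (subring_sum sV) => j _.
  rewrite (_ : _ / h = (g * jacobian w' D i j) * (t * D' j h / h)); last by ring.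
  apply: (subringM sV) => //; have dD'j : derivation_of iota V (D' j) by case: cw'.
  apply: (logarithmic_derivative dvrV) => //.
  by rewrite mulrAC divff // mul1r; exact: (coords_der_in cw' j Vt).
have D0 i : D i 0 = 0 by exact: (der0 (coords_der cw i)).
have bound (l' : seq 'I_dR) h : h != 0 -> foldl (fun g i => D (fR i) g) h l' != 0 ->
    ord V h <= (size l')%:Z * (ord V g + 1) + ord V (foldl (fun g i => D (fR i) g) h l').
  elim: l' h => [|i l' IH] h h0 /=; first by rewrite mul0r add0r.
  case: (eqVneq (D (fR i) h) 0) => [->|Dh0].
    have -> : foldl (fun g i => D (fR i) g) 0 l' = 0 by elim: (l') => //= j q IHq; rewrite D0.
    by rewrite eqxx.
  move=> /(IH _ Dh0); have := step (fR i) h h0 => /(ord_in dvrV).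
  rewrite !mulf_neq0 ?invr_eq0 // => /(_ isT).
  rewrite !(ordM dvrV) ?mulf_neq0 ?invr_eq0 // (ordV dvrV) // (ord_uniformizer dvrV).
  by rewrite -[(size l').+1]addn1 PoszD mulrDl mul1r; lia.
have := bound l f f0 (units_neq0 ul).
by rewrite (ord_unit dvrV (units_sub RV ul)) addr0.
Qed.

Lemma log_discrepancy V S d (x : 'I_d -> K) : divisorial R V ->
  regular_model iota S -> regular_parameters S x -> R `<=` S -> S `<=` V ->
  (forall i, is_local_ring (param_divisor S x i) /\ is_noetherian (param_divisor S x i)) ->
  \sum_i (rel_canonical_coef iota R (param_divisor S x i) + 1) * ord V (x i)
    <= rel_canonical_coef iota R V + 1.
Proof.
move=> dV mS rx RS SV rL.
have [t [dvrV [n [i0 [w' [D' [cw' wt]]]]]]] := divisorial_coords dV.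
have [nR [fR [wR [DR [_ cR _]]]]] := regular_model_coords k0 mR rR.
have [nS [f [w [D [injf cw wx]]]]] := regular_model_coords k0 mS rx.
have e := coords_dim cR cw'; subst nR; have e := coords_dim cw cw'; subst nS.
have [RV _ _ _] := dV; have [sV _ _ _ _] := dvrV.
have sS : subring_set S by case: mS => -[].
have x0 := params_neq0 injf cw wx.
have xS := params_in rx.
set g := \det (jacobian wR D).
have g0 : g != 0 by exact: jacobian_neq0 cR cw.
have Sg : S g.
  apply: det_in => // i j; apply: (jacobian_in cR RS) => l y Sy.
  exact: (coords_der_in cw l Sy).
(* The coordinates [w] of [S] are still coordinates on each parameter divisor, so one element [g] of
   [S] computes all these coefficients. *)
have eg i : rel_canonical_coef iota R (param_divisor S x i) = ord (param_divisor S x i) g.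
  apply: (rel_canonical_eq sR _ _ cR (param_divisor_coords mS rx injf cw wx i)).
    exact: subset_trans RS (@sub_param_divisor _ _ _ _ _ _ _ mS rx injf cw wx i).
  by apply: (param_divisor_dvr mS rx injf cw wx); case: (rL i).
pose m i := `|ord (param_divisor S x i) g|%N.
have em i : (m i)%:Z = ord (param_divisor S x i) g.
  rewrite gez0_abs //; apply: (@ord_in _ _ (x i)) => //.
    by apply: (param_divisor_dvr mS rx injf cw wx); case: (rL i).
  exact: (@sub_param_divisor _ _ _ _ _ _ _ mS rx injf cw wx i).
have [|h Sh eh] := param_divisors_dvd mS rx injf cw wx rL Sg g0 (m := m).
  by move=> i; rewrite em.
have p0 : \prod_i x i ^+ m i != 0.
  by apply/prodf_neq0 => i _; rewrite expf_neq0 // x0.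
have h0 : h != 0 by apply: contraNneq g0 => h0; rewrite eh h0 mulr0.
have og : ord V g = \sum_i (rel_canonical_coef iota R (param_divisor S x i)) * ord V (x i) + ord V h.
  rewrite {1}eh (ordM dvrV) // (ord_prod dvrV); last by move=> i _; rewrite expf_neq0 // x0.
  by congr (_ + _); apply: eq_bigr => i _; rewrite (ordX dvrV) // em eg.
(* Chain rule: the determinant from V to R is the product of the one from V to S, bounded by
   [ord_jacobian_ge], and of [g]. *)
rewrite (rel_canonical_eq sR RV dvrV cR cw') (jacobian_comp cR cw cw') det_mulmx -/g.
rewrite (ordM dvrV) ?(jacobian_neq0 cw cw') // og.
under eq_bigr => i _ do rewrite mulrDl mul1r.
rewrite big_split /=.
have := ord_jacobian_ge dvrV cw' wt cw SV injf wx x0.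
have := ord_in dvrV (SV _ Sh) h0.
move: (\sum_i ord V (x i)) (\sum_i _ * _) (ord V h) (ord V (\det _)) => A B C E.
lia.
Qed.

Lemma log_resolution_center N b V : log_resolution R b N -> divisorial R V ->
  exists S d (x : 'I_d -> K) (J : {set 'I_d}) (e : 'I_d -> nat),
  [/\ N S, [/\ regular_model iota S, regular_parameters S x, R `<=` S, S `<=` V &
        nonunits S `<=` nonunits V], b `<=` S &
      ideal_gen S b = ideal_gen S [set \prod_(i in J) x i ^+ e i]].
Proof.
move=> [pN regN snc] dV; have [t [dvrV _]] := divisorial_coords dV.
have [RV _ _ _] := dV; have [sV t0 Vt _ _] := dvrV.
have [_ /(_ V (dvr_valuation_ring dvrV) RV)[S [[NS [SV dom]] _]]] := pN.
have [d [x [J [e [rx _ eb]]]]] := snc S NS.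
have mS := point_regular_model mR pN NS (regN _ NS).
have [[sS _] _ _ _] := mS.
exists S, d, x, J, e; split=> //; first by split=> //; exact: (point_sub pN).
(* If [b] were not inside [S], no ideal of [S] would contain it and [ideal_gen S b], an empty
   intersection, would be all of [K]; but it is principal in [S] and cannot contain the inverse of
   [t]. *)
apply: contrapT => nb.
have Sp : S (\prod_(i in J) x i ^+ e i).
  by apply: (subring_prod sS) => i _; apply: (subringX sS); exact: params_in rx i.
have : ideal_gen S b t^-1.
  by move=> A [[AS _ _ _] bA]; case: nb; exact: subset_trans AS.
rewrite eb => /(ideal_gen1P _ sS Sp)[c Sc et].
have [_ []] := dvr_nonunit dvrV; apply/(unitsE _ sV); split=> //.
by apply: SV; rewrite et; exact: (subringM sS).
Qed.

Lemma ideal_gen_mono S V b mu : subring_set S -> subring_set V -> S `<=` V -> b `<=` S ->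
  S mu -> ideal_gen S b = ideal_gen S [set mu] -> ideal_gen V b = ideal_gen V [set mu].
Proof.
move=> sS sV SV bS Smu eb; have iV := @ideal_gen_ideal K V.
have bV := subset_trans bS SV.
have hmu : [set mu] `<=` V by move=> _ ->; exact: SV.
apply/seteqP; split; apply: smallest_sub; try exact: iV.
  move=> f bf; have : ideal_gen S b f by apply: sub_gen_smallest.
  rewrite eb => /(ideal_gen1P _ sS Smu)[c Sc ->].
  by apply/(ideal_gen1P _ sV (SV _ Smu)); exists c => //; exact: SV.
move=> _ ->; have : ideal_gen S b mu by rewrite eb => A [_]; apply.
move=> /(_ [set f | S f /\ ideal_gen V b f])[]//.
split; last by move=> f bf; split; [exact: bS|exact: sub_gen_smallest].
have [gV g0 gD gM] := iV _ sV bV; have [? ? ?] := self_submodule sS.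
split; first by move=> ? [].
- by split.
- by move=> f g [Sf gf] [Sg gg]; split; [exact: (subringD sS)|exact: gD].
- by move=> c f Sc [Sf gf]; split; [exact: (subringM sS)|apply: gM => //; exact: SV].
Qed.

(** Read off the monomial generator at the center; applied to b_m, of which only its definition and
    a log resolution are given. *)
Lemma log_resolution_sub N b V : log_resolution R b N -> divisorial R V ->
  b `<=` V /\ exists2 f, b f & f != 0.
Proof.
move=> rN dV; have [S [d [x [J [e [NS [mS rx RS SV _] bS eb]]]]]] := log_resolution_center rN dV.
split; first exact: subset_trans SV.
have [nS [f [w [D [injf cw wx]]]]] := regular_model_coords k0 mS rx.
have sS : subring_set S by case: mS => -[].
apply: contrapT => nb; have b0 : b `<=` [set 0].
  by move=> g bg /=; apply/eqP; apply: contra_notT nb => g0; exists g.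
have h : ideal_gen S b (\prod_(i in J) x i ^+ e i).
  by rewrite eb => A [_]; apply.
have /eqP : [set 0] (\prod_(i in J) x i ^+ e i).
  apply: h; split=> //; have [? ? ?] := zero_submodule S.
  by split=> // _ ->; exact: (subring0 sS).
apply/negP/prodf_neq0 => i _; rewrite expf_neq0 //.
exact: params_neq0 injf cw wx i.
Qed.

(** A mediant inequality: ord_V(b) = \sum_(i in J) e_i ord_V(x_i) while c_V >= \sum_i c_i
    ord_V(x_i), so some ratio c_i / e_i with e_i > 0 is at most c_V / ord_V(b). *)
Theorem lc_on_le (T : realType) N b V : log_resolution R b N -> divisorial R V ->
  (0 < ord_ideal V b)%N ->
  (lc_on iota T R N b <= ((rel_canonical_coef iota R V + 1)%:~R / (ord_ideal V b)%:R)%:E)%E.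
Proof.
move=> rN dV b_gt0; have [t [dvrV _]] := divisorial_coords dV.
have [S [d [x [J [e [NS [mS rx RS SV dom] bS eb]]]]]] := log_resolution_center rN dV.
have [nS [f [w [D [injf cw wx]]]]] := regular_model_coords k0 mS rx.
have sS : subring_set S by case: mS => -[].
have [sV _ _ _ _] := dvrV.
have [pN regN _] := rN.
have xi0 := params_neq0 injf cw wx; have xS := params_in rx.
pose L i := param_divisor S x i.
have NL i : N (L i).
  by apply: (point_generization pN NS); exact: (param_divisor_prime mS rx injf cw wx).
have rL i : is_local_ring (L i) /\ is_noetherian (L i).
  by case: (regN _ (NL i)).
have dL i : dvr (L i) (x i) by apply: (param_divisor_dvr mS rx injf cw wx); case: (rL i).
have SL i : S `<=` L i by exact: (@sub_param_divisor _ _ _ _ _ _ _ mS rx injf cw wx i).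
set mu := \prod_(i in J) x i ^+ e i in eb.
have Smu : S mu by apply: (subring_prod sS) => i _; exact: (subringX sS).
have mu0 : mu != 0 by apply/prodf_neq0 => i _; rewrite expf_neq0 // xi0.
have ob : (ord_ideal V b)%:Z = \sum_(i in J) (e i)%:Z * ord V (x i).
  rewrite (ord_ideal_eq dvrV (SV _ Smu) mu0 (ideal_gen_mono sS sV SV bS Smu eb)).
  rewrite (ord_prod dvrV); last by move=> i _; rewrite expf_neq0 // xi0.
  by apply: eq_bigr => i _; rewrite (ordX dvrV) // xi0.
have obL i : i \in J -> ord_ideal (L i) b = e i.
  move=> iJ; have [sL _ _ _ _] := dL i; apply/eqP; rewrite -eqz_nat.
  rewrite (ord_ideal_eq (dL i) (SL i _ Smu) mu0 (ideal_gen_mono sS sL (@SL i) bS Smu eb)).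
  rewrite (ord_prod (dL i)); last by move=> j _; rewrite expf_neq0 // xi0.
  rewrite (bigD1 i) //= big1 ?addr0 ?(ordX (dL i)) ?xi0 //.
    by rewrite (ord_uniformizer (dL i)) mulr1.
  move=> j /andP[_ ji]; rewrite (ordX (dL i)) ?xi0 //.
  by rewrite (ord_param_divisor_other mS rx injf cw wx rL ji) mulr0.
(* Domination of the center by [V]; positivity keeps the inequality strict in the summation
   below. *)
have ox i : 0 < ord V (x i).
  by apply/(ord_gt0 dvrV (xi0 i)); apply: dom; case: rx => _ ->; move=> A [_]; apply; exists i.
have key := log_discrepancy dV mS rx RS SV rL.
pose g i := rel_canonical_coef iota R (L i); rewrite -/(g _) in key.
have divL i : divisorial R (L i).
  apply: prime_divisor_divisorial rN _; split=> //; exact: dvr_krull_dim (dL i).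
have g_ge0 i : 0 <= g i by exact: rel_canonical_ge0.
set B := ord_ideal V b in ob b_gt0 *; set G := rel_canonical_coef iota R V in key *.
have [i [iJ ei le]] : exists i, [/\ i \in J, (0 < e i)%N & (g i + 1) * B%:Z <= (G + 1) * (e i)%:Z].
  apply: contrapT => none.
  have lt i : i \in J -> (0 < e i)%N -> (G + 1) * (e i)%:Z < (g i + 1) * B%:Z.
    by move=> iJ ei; rewrite ltNge; apply/negP => le; apply: none; exists i.
  have [i iJ ei] : exists2 i, i \in J & (0 < e i)%N.
    apply: contrapT => no; move: ob; rewrite big1 => [|i iJ]; first by move: b_gt0; clear; lia.
    case: (posnP (e i)) => [->|ei]; first by rewrite mul0r.
    by case: no; exists i.
  have G0 : 0 <= G by exact: rel_canonical_ge0.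
  have : (G + 1) * B%:Z < (\sum_i (g i + 1) * ord V (x i)) * B%:Z.
    rewrite ob mulr_sumr mulr_suml [X in _ < X](bigID (mem J)) /= -ob.
    rewrite -[X in X < _]addr0; apply: ltr_leD; last first.
      by apply: sumr_ge0 => j _; rewrite !mulr_ge0 ?addr_ge0 // ltW.
    rewrite (bigD1 i) //= [X in _ < X](bigD1 i) //=; apply: ltr_leD.
      by rewrite mulrA [X in _ < X]mulrAC ltr_pM2r //; exact: lt.
    apply: ler_sum => j /andP[jJ _]; rewrite mulrA [X in _ <= X]mulrAC ler_pM2r //.
    case: (posnP (e j)) => [->|ej]; last by apply/ltW/lt.
    by rewrite mulr0 mulr_ge0 // addr_ge0.
  by apply/negP; rewrite -leNgt ler_wpM2r.
apply: (@le_trans _ _ ((g i + 1)%:~R / (e i)%:R)%:E).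
  apply: ereal_inf_lbound; exists (L i); last by rewrite obL.
  by split; [split=> //; exact: dvr_krull_dim (dL i)|rewrite obL].
rewrite lee_fin ler_pdivrMr ?ltr0n // mulrAC ler_pdivlMr ?ltr0n //.
have := le; rewrite -(ler_int T) !intrM => h.
exact: h.
Qed.
End OverR.
End Discrepancies.

(** * Limits *)

Section Limits.
Variable T : realType.

(** For an infinite limit the upper condition is vacuous; [0 <= L] excludes minus infinity. *)
Lemma cvg_ereal_squeeze (u : nat -> \bar T) (L : \bar T) : (0 <= L)%E ->
  (forall x : T, (x%:E < L)%E -> \forall n \near \oo, (x%:E < u n)%E) ->
  (forall x : T, (L < x%:E)%E -> \forall n \near \oo, (u n < x%:E)%E) ->
  u @ \oo --> L.
Proof.
case: L => [l| |] // _ lo up.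
- move=> A [/= e e0 eA].
  have h1 : \forall n \near \oo, ((l - e)%:E < u n)%E by apply: lo; rewrite lte_fin ltrBlDr ltrDl.
  have h2 : \forall n \near \oo, (u n < (l + e)%:E)%E by apply: up; rewrite lte_fin ltrDl.
  suff : \forall n \near \oo, A (u n) by [].
  near=> n.
  have : ((l - e)%:E < u n)%E by near: n.
  have : (u n < (l + e)%:E)%E by near: n.
  rewrite /=; case: (u n) => [y| |] //; rewrite !lte_fin => y1 y2.
  by apply: eA; rewrite /ball /= ltr_distlC y1 y2.
- by apply/cvgeyPgt => A; apply: lo; rewrite ltry.
Unshelve. all: by end_near.
Qed.

(** * Asymptotics of infima of ratios, with c for c_V, alpha for ord_V(a_m) and beta for
    ord_V(b_m) *)

Section GradedOrders.
Variables (I : Type) (P : set I) (c : I -> T) (alpha beta : nat -> I -> nat).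
Hypothesis c_gt0 : forall i, P i -> 0 < c i.

Definition inf_ratio (Q : set I) (f : I -> nat) : \bar T :=
  ereal_inf [set (c i / (f i)%:R)%:E | i in [set i | Q i /\ (0 < f i)%N]].

Hypothesis alphaD : forall p q i, P i -> (alpha (p + q) i <= alpha p i + alpha q i)%N.
Hypothesis alpha_bound : forall m, exists e : nat, forall i, P i -> (alpha m i)%:R <= e%:R * c i.
Hypothesis beta_le : forall m i, (0 < m)%N -> P i -> (beta m i <= alpha m i)%N.
(** [Q] stands for the prime divisors of one log resolution of a_p: the multiplier ideal constrains
    orders only there, but the infimum for a_p is the same. *)
Hypothesis beta_ge : forall m, (0 < m)%N -> exists2 p, (0 < p)%N & exists2 Q : set I, Q `<=` P &
  inf_ratio Q (alpha p) = inf_ratio P (alpha p) /\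
  forall i, Q i -> m%:R * (alpha p i)%:R < p%:R * ((beta m i)%:R + c i).

Let u m : \bar T := (m%:R%:E * inf_ratio P (alpha m))%E.
Let v m : \bar T := (m%:R%:E * inf_ratio P (beta m))%E.
Let L : \bar T := ereal_sup [set u m | m in [set m | (0 < m)%N]].

Lemma inf_ratio_ge0 f : (0 <= inf_ratio P f)%E.
Proof.
by apply: le_ereal_inf_tmp => _ [i [Pi _] <-]; rewrite lee_fin divr_ge0 // ltW ?c_gt0.
Qed.

(** The extra term is the case q = 0: a_0 may be a proper ideal. *)
Lemma alphaMn p q i : P i -> (alpha (q * p) i <= q * alpha p i + alpha 0 i)%N.
Proof.
move=> Pi; elim: q => [|q IH]; first by rewrite !mul0n.
by rewrite mulSn mulSn -addnA (leq_trans (alphaD _ _ Pi)) // leq_add2l.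
Qed.

Lemma alpha_bounded p : exists e : nat, forall r i, (r < p)%N -> P i ->
  (alpha r i)%:R <= e%:R * c i.
Proof.
elim: p => [|p [e IH]]; first by exists 0%N.
have [e' he'] := alpha_bound p; exists (e + e')%N => r i.
have ci j : P j -> 0 <= c j by move=> /c_gt0 /ltW.
rewrite ltnS leq_eqVlt natrD mulrDl => /predU1P[->|lt] Pi.
  by apply: (le_trans (he' i Pi)); rewrite lerDr mulr_ge0 // ci.
by apply: (le_trans (IH r i lt Pi)); rewrite lerDl mulr_ge0 // ci.
Qed.

Lemma le_inf_ratio (x : T) f : (forall i, P i -> x * (f i)%:R <= c i) -> (x%:E <= inf_ratio P f)%E.
Proof.
move=> h; apply: le_ereal_inf_tmp => _ [i [Pi fi] <-].
by rewrite lee_fin ler_pdivlMr ?ltr0n // h.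
Qed.

(** Fekete's argument made uniform in the index: all remainders are bounded by one multiple of
    c_i. *)
Lemma u_lower (x : T) : (x%:E < L)%E -> \forall n \near \oo, (x%:E < u n)%E.
Proof.
have [x0 _|x0] := ltP x 0.
  by near=> n; apply: (@lt_le_trans _ _ 0%E); [rewrite lte_fin|
    rewrite /u mule_ge0 ?inf_ratio_ge0 // lee_fin].
move=> /ereal_sup_gt[_ [p p0 <-] xu].
(* A real number is chosen, since [u p] may be infinite. *)
have [y xy yu] : exists2 y, x < y & (y%:E <= u p)%E.
  move: xu; case: (u p) => [z| |] //; last by exists (x + 1); rewrite ?ltrDl ?leey.
  by rewrite lte_fin => xz; exists z.
have y0 : 0 < y by exact: le_lt_trans xy.
have p0' : 0 < p%:R :> T by rewrite ltr0n.
have bp i : P i -> y * (alpha p i)%:R <= p%:R * c i.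
  move=> Pi; case: (posnP (alpha p i)) => [->|ai].
    by rewrite mulr0 mulr_ge0 // ltW // c_gt0.
  have : (u p <= (p%:R * (c i / (alpha p i)%:R))%:E)%E.
    rewrite /u EFinM lee_pmul2l //; apply: ereal_inf_lbound; by exists i.
  move=> /(le_trans yu); rewrite lee_fin mulrA ler_pdivlMr ?ltr0n //.
have [e he] := alpha_bounded p; have [e0 he0] := alpha_bound 0.
pose E : T := (e + e0)%:R.
have E0 : 0 <= E by [].
(* Write n = r + q p. The q blocks cost at most (n / y) c_i by the choice of y; the remainder and
   [alpha 0] go into [E], which depends on p only. *)
have bn n i : P i -> (alpha n i)%:R <= (n%:R / y + E) * c i.
  move=> Pi; have ci := ltW (c_gt0 Pi).
  rewrite (divn_eq n p) addnC; set q := (n %/ p)%N; set r := (n %% p)%N.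
  have lt : (r < p)%N by rewrite ltn_mod.
  have h1 : (alpha (r + q * p) i <= alpha r i + (q * alpha p i + alpha 0 i))%N.
    by rewrite (leq_trans (alphaD _ _ Pi)) // leq_add2l alphaMn.
  apply: (@le_trans _ _ ((alpha r i)%:R + (q%:R * (alpha p i)%:R + (alpha 0 i)%:R))).
    by rewrite -natrM -!natrD ler_nat.
  rewrite mulrDl /E natrD mulrDl.
  have b1 := he r i lt Pi; have b2 := he0 i Pi.
  have b3 : q%:R * (alpha p i)%:R <= (r + q * p)%:R / y * c i.
    rewrite mulrAC ler_pdivlMr //; apply: (@le_trans _ _ (q%:R * (p%:R * c i))).
      by rewrite -mulrA ler_wpM2l // mulrC bp.
    by rewrite mulrA -natrM ler_wpM2r // ler_nat leq_addl.
  lra.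
have un n : (0 < n)%N -> ((n%:R / (n%:R / y + E))%:E <= u n)%E.
  move=> n0; have n0' : 0 < n%:R :> T by rewrite ltr0n.
  have d0 : 0 < n%:R / y + E by rewrite ltr_pwDl // divr_gt0.
  rewrite /u EFinM lee_pmul2l //; apply: le_inf_ratio => i Pi.
  by rewrite mulrC ler_pdivrMr // mulrC bn.
have yx : 0 < y - x by rewrite subr_gt0.
near=> n.
have n0 : (0 < n)%N by near: n; exists 1%N.
have n0' : 0 < n%:R :> T by rewrite ltr0n.
apply: lt_le_trans (un n n0); rewrite lte_fin.
have d0 : 0 < n%:R / y + E by rewrite ltr_pwDl // divr_gt0.
rewrite ltr_pdivlMr //.
(* Exactly the condition for n / (n / y + E) > x. *)
have hn : x * E * y / (y - x) < n%:R by near: n; exact: nbhs_infty_gtr.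
rewrite ltr_pdivrMr // in hn.
rewrite -subr_gt0 (_ : _ - _ = (n%:R * (y - x) - x * E * y) / y); last by field; rewrite gt_eqF.
by rewrite divr_gt0 // subr_gt0.
Unshelve. all: by end_near.
Qed.

Lemma u_le_L n : (0 < n)%N -> (u n <= L)%E.
Proof. by move=> n0; apply: ereal_sup_ubound; exists n. Qed.

Lemma L_ge0 : (0 <= L)%E.
Proof. by apply: le_trans (u_le_L (ltn0Sn 0)); rewrite /u mule_ge0 ?inf_ratio_ge0. Qed.

Lemma u_le_v n : (0 < n)%N -> (u n <= v n)%E.
Proof.
move=> n0; rewrite /u /v lee_pmul2l ?lte_fin ?ltr0n //.
apply: le_ereal_inf_tmp => _ [i [Pi bi] <-].
have ai := leq_trans bi (beta_le n0 Pi).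
apply: (@le_trans _ _ (c i / (alpha n i)%:R)%:E); first by apply: ereal_inf_lbound; exists i.
rewrite lee_fin ler_pM2l ?c_gt0 // lef_pV2 ?posrE ?ltr0n // ler_nat.
exact: beta_le.
Qed.

(** With L < y < x, some i in [Q] has p c_i < y alpha_p(i). Eliminating alpha_p(i) with [beta_ge]
    gives (m - y) c_i < y beta_m(i), so m c_i / beta_m(i) < m y / (m - y), which is below x as soon
    as m > x y / (x - y). The integer p depends on m but drops out. *)
Lemma v_upper (x : T) : (L < x%:E)%E -> \forall n \near \oo, (v n < x%:E)%E.
Proof.
move=> Lx; have [y [Ly yx]] : exists y : T, (L < y%:E)%E /\ y < x.
  move: Lx L_ge0; case: L => [l| |] //; rewrite lte_fin => lx _.
  by exists ((l + x) / 2); rewrite lte_fin; split; lra.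
have y0 : 0 < y by rewrite -lte_fin; apply: le_lt_trans Ly; exact: L_ge0.
near=> m.
have m0 : (0 < m)%N by near: m; exists 1%N.
have [p p0 [Q QP [eQ bQ]]] := beta_ge m0.
have p0' : 0 < p%:R :> T by rewrite ltr0n.
have : (inf_ratio Q (alpha p) < (y / p%:R)%:E)%E.
  rewrite eQ -(@lte_pmul2l _ p%:R%:E) // ?lte_fin //.
  rewrite -EFinM mulrCA divff ?gt_eqF // mulr1.
  by apply: le_lt_trans Ly; exact: u_le_L.
move=> /ereal_inf_lt[_ [i [Qi ai] <-]]; rewrite lte_fin => hi.
have Pi := QP _ Qi; have ci := c_gt0 Pi; have bi := bQ i Qi.
have ai' : 0 < (alpha p i)%:R :> T by rewrite ltr0n.
have my : y < m%:R by near: m; exact: nbhs_infty_gtr.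
have mx : x * y / (x - y) < m%:R by near: m; exact: nbhs_infty_gtr.
have hi' : c i * p%:R < y * (alpha p i)%:R.
  by move: hi; rewrite ltr_pdivrMr // mulrAC ltr_pdivlMr.
have hb : (m%:R - y) * c i < y * (beta m i)%:R.
  rewrite -(ltr_pM2l p0').
  have h1 : m%:R * (c i * p%:R) < m%:R * (y * (alpha p i)%:R) by rewrite ltr_pM2l // ltr0n.
  have h2 : y * (m%:R * (alpha p i)%:R) < y * (p%:R * ((beta m i)%:R + c i)) by rewrite ltr_pM2l.
  move: h1 h2; rewrite !mulrDr !mulrBl mulrBr => h1 h2.
  rewrite ltrBlDr; apply: (@lt_trans _ _ (m%:R * (y * (alpha p i)%:R))).
    by rewrite (_ : p%:R * _ = m%:R * (c i * p%:R)) //; ring.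
  rewrite (_ : m%:R * _ = y * (m%:R * (alpha p i)%:R)); last by ring.
  by apply: (lt_le_trans h2); rewrite le_eqVlt; apply/orP; left; apply/eqP; ring.
(* The infimum defining [v m] only runs over indices with positive beta. *)
have b0 : 0 < (beta m i)%:R :> T.
  rewrite -(pmulr_rgt0 _ y0); apply: le_lt_trans hb.
  by rewrite mulr_ge0 // ?subr_ge0 ltW.
have m0' : 0 < m%:R :> T by rewrite ltr0n.
apply: (@le_lt_trans _ _ (m%:R * (c i / (beta m i)%:R))%:E).
  rewrite /v EFinM lee_pmul2l ?lte_fin //; apply: ereal_inf_lbound; exists i => //.
  by split=> //; rewrite -(ltr0n T).
rewrite lte_fin mulrA ltr_pdivrMr //.
have my' : 0 < m%:R - y by rewrite subr_gt0.
rewrite ltr_pdivrMr ?subr_gt0 // in mx.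
have h3 : m%:R * ((m%:R - y) * c i) < m%:R * (y * (beta m i)%:R) by rewrite ltr_pM2l.
rewrite -(ltr_pM2l my').
apply: (@lt_trans _ _ (m%:R * (y * (beta m i)%:R))).
  by rewrite (_ : _ * _ = m%:R * ((m%:R - y) * c i)) //; ring.
rewrite !mulrA ltr_pM2r //; move: mx; rewrite !mulrBr !mulrBl => mx; lra.
Unshelve. all: by end_near.
Qed.

Theorem graded_orders_limit : u @ \oo --> L /\ v @ \oo --> L.
Proof.
split; apply: cvg_ereal_squeeze L_ge0 _ _.
- exact: u_lower.
- by move=> x Lx; exists 1%N => // n n0; apply: le_lt_trans Lx; exact: u_le_L.
- move=> x /u_lower [N _ h]; exists (maxn N 1) => // n /=; rewrite geq_max => /andP[Nn n1].
  by apply: lt_le_trans (u_le_v n1); exact: h.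
- exact: v_upper.
Qed.
End GradedOrders.
End Limits.

(** * Graded sequences of ideals *)

Section GradedSequences.
Variables (k : closedFieldType) (K : fieldType) (iota : {rmorphism k -> K}).
Hypothesis k0 : [pchar k] =i pred0.
Variables (R : set K) (dR : nat) (xR : 'I_dR -> K) (T : realType).
Hypotheses (mR : regular_model iota R) (rR : regular_parameters R xR).

Definition log_disc (V : set K) : T := (rel_canonical_coef iota R V + 1)%:~R.

Lemma log_disc_gt0 V : divisorial iota R V -> 0 < log_disc V.
Proof.
by move=> dV; rewrite ltr0z; have := rel_canonical_ge0 k0 mR rR dV; lia.
Qed.

Lemma lc_on_divisorial M a : log_resolution R a M ->
  lc_on iota T R M a = inf_ratio log_disc (divisorial iota R) (fun V => ord_ideal V a).
Proof.
move=> rM; apply/eqP; rewrite eq_le; apply/andP; split; last first.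
  apply: ereal_inf_le_tmp => _ [V [pV oV] <-]; exists V => //; split=> //.
  exact: (prime_divisor_divisorial mR rM pV).
apply: le_ereal_inf_tmp => _ [V [dV oV] <-]; exact: (lc_on_le k0 mR rR).
Qed.

Variables (a b : nat -> set K) (lca lcb : nat -> \bar T).
Hypothesis graded_a : graded_sequence_of_nonzero_ideals R a.
Hypothesis def_b : forall m : nat, (0 < m)%N ->
  is_asymptotic_multiplier_ideal iota R m%:R a (b m).
Hypothesis def_lca : forall m : nat, (0 < m)%N -> is_lc iota R (a m) (lca m).
Hypothesis def_lcb : forall m : nat, (0 < m)%N -> is_lc iota R (b m) (lcb m).

Lemma graded_min V t m : divisorial iota R V -> dvr V t ->
  exists f, [/\ a m f, f != 0, (ord_ideal V (a m))%:Z = ord V f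
    & forall g, a m g -> g != 0 -> ord V f <= ord V g].
Proof.
move=> dV dvrV; have [ia na _] := graded_a; apply: (ord_ideal_min dvrV); last exact: na.
by have [RV _ _ _] := dV; have [aR _ _ _] := ia m; exact: subset_trans RV.
Qed.

Lemma graded_ordD p q V : divisorial iota R V ->
  (ord_ideal V (a (p + q)) <= ord_ideal V (a p) + ord_ideal V (a q))%N.
Proof.
move=> dV; have [t [dvrV _]] := divisorial_coords k0 dV; have [_ _ aM] := graded_a.
have [f [af f0 ef _]] := graded_min p dV dvrV.
have [g [ag g0 eg _]] := graded_min q dV dvrV.
have [h [_ _ eh mh]] := graded_min (p + q) dV dvrV.
by rewrite -lez_nat PoszD ef eg eh -(ordM dvrV) // mh ?mulf_neq0 //; exact: aM.
Qed.

(** A single nonzero element of a_m already bounds its order along all divisors. *)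
Lemma graded_ord_bound m : exists e : nat, forall V, divisorial iota R V ->
  (ord_ideal V (a m))%:R <= e%:R * log_disc V.
Proof.
have [ia na _] := graded_a; have [f af f0] := na m; have [aR _ _ _] := ia m.
have [e he] := order_bound k0 mR rR (aR _ af) f0; exists e => V dV.
have [t [dvrV _]] := divisorial_coords k0 dV.
have [h [_ _ eh mh]] := graded_min m dV dvrV.
have := le_trans (mh f af f0) (he V dV).
by rewrite -eh -(ler_int T) intrM.
Qed.

(** Take p = m in the maximality of b_m: the exponent is then 1, no rounding occurs, and a_m lies in
    its multiplier ideal because the relative canonical divisor is effective. *)
Lemma sub_asymptotic m : (0 < m)%N -> a m `<=` b m.
Proof.
move=> m0; have [_ maxb] := def_b m0; have [M rM _] := def_lca m0.
apply: subset_trans (maxb m _ m0 _); last by exists M.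
move=> h ah; case: (eqVneq h 0) => [->|h0]; [by left|right => V pV].
have dV := prime_divisor_divisorial mR rM pV.
have [t [dvrV _]] := divisorial_coords k0 dV.
have [g [_ _ eg mg]] := graded_min m dV dvrV.
rewrite divff ?pnatr_eq0 -?lt0n // mul1r.
have -> : Num.floor ((ord_ideal V (a m))%:R : rat) = (ord_ideal V (a m))%:Z.
  by rewrite -[X in Num.floor X]/((ord_ideal V (a m))%:Z%:~R) intrKfloor.
by have := mg h ah h0; have := rel_canonical_ge0 k0 mR rR dV; rewrite eg; lia.
Qed.

Lemma asymptotic_min V t m : (0 < m)%N -> divisorial iota R V -> dvr V t ->
  exists f, [/\ b m f, f != 0, (ord_ideal V (b m))%:Z = ord V f
    & forall g, b m g -> g != 0 -> ord V f <= ord V g].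
Proof.
move=> m0 dV dvrV; have [N rN _] := def_lcb m0.
by have [bV nb] := log_resolution_sub k0 mR rN dV; apply: (ord_ideal_min dvrV).
Qed.

Lemma asymptotic_ord_le m V : (0 < m)%N -> divisorial iota R V ->
  (ord_ideal V (b m) <= ord_ideal V (a m))%N.
Proof.
move=> m0 dV; have [t [dvrV _]] := divisorial_coords k0 dV.
have [f [_ _ ef mf]] := asymptotic_min m0 dV dvrV.
have [g [ag g0 eg _]] := graded_min m dV dvrV.
by rewrite -lez_nat ef eg; apply: mf => //; exact: sub_asymptotic.
Qed.

Lemma asymptotic_ord_ge m : (0 < m)%N -> exists2 p, (0 < p)%N &
  exists2 Q : set (set K), Q `<=` divisorial iota R &
  inf_ratio log_disc Q (fun V => ord_ideal V (a p)) =
    inf_ratio log_disc (divisorial iota R) (fun V => ord_ideal V (a p)) /\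
  forall V, Q V -> m%:R * (ord_ideal V (a p))%:R < p%:R * ((ord_ideal V (b m))%:R + log_disc V).
Proof.
move=> m0; have [[p p0 [M rM eb]] _] := def_b m0; exists p => //.
exists (prime_divisor M); first by move=> V; exact: (prime_divisor_divisorial mR rM).
split; first exact: lc_on_divisorial.
move=> V pV; have dV := prime_divisor_divisorial mR rM pV.
have [t [dvrV _]] := divisorial_coords k0 dV.
have [h [bh h0 eh _]] := asymptotic_min m0 dV dvrV.
have : multiplier_ideal_on iota R M (m%:R / p%:R) (a p) h by rewrite -eb.
case=> [/eqP|/(_ V pV)]; first by rewrite (negbTE h0).
rewrite -eh; set A := ord_ideal V (a p); set B := ord_ideal V (b m).
set G := rel_canonical_coef iota R V => hB.
have p0' : 0 < p%:R :> rat by rewrite ltr0n.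
(* For integers n, the inequality [q] <= n is q < n + 1; here n is ord_V(b_m) + gamma_V. *)
have lt : m%:R / p%:R * A%:R < (B%:Z + (G + 1))%:~R :> rat.
  by rewrite -floor_lt_int; move: hB; move: (Num.floor _) => F; lia.
have lt' : m%:Z * A%:Z < p%:Z * (B%:Z + (G + 1)).
  rewrite -(ltr_int rat) !intrM.
  by rewrite -(ltr_pM2l p0') in lt; move: lt; rewrite mulrA mulrCA divff ?mulr1 // gt_eqF.
by move: lt'; rewrite -(ltr_int T) !intrM intrD.
Qed.

Theorem graded_limit : let u := fun m : nat => (m%:R%:E * lca m)%E in
  let v := fun m : nat => (m%:R%:E * lcb m)%E in
  exists l : \bar T, u @ \oo --> l /\ v @ \oo --> l.
Proof.
move=> u v.
pose w (c : nat -> set K) m : \bar T :=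
  (m%:R%:E * inf_ratio log_disc (divisorial iota R) (fun V => ord_ideal V (c m)))%E.
have -> : u = w a.
  (* Nothing is known of [lca 0], but the factor 0 makes both terms vanish at m = 0. *)
  apply/funext => -[|m]; rewrite /u /w ?mul0e //; congr (_ * _)%E.
  by have [M rM ->] := def_lca (ltn0Sn m); exact: lc_on_divisorial.
have -> : v = w b.
  apply/funext => -[|m]; rewrite /v /w ?mul0e //; congr (_ * _)%E.
  by have [M rM ->] := def_lcb (ltn0Sn m); exact: lc_on_divisorial.
have [hu hv] := graded_orders_limit log_disc_gt0 graded_ordD graded_ord_bound
  asymptotic_ord_le asymptotic_ord_ge.
by eexists; split; [exact: hu|exact: hv].
Qed.
End GradedSequences.

Theorem theorem3p6 (k : closedFieldType) (K : fieldType)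
    (iota : {rmorphism k -> K}) (R : set K) (a b : nat -> set K)
    (T : realType) (lca lcb : nat -> \bar T)
    (char_k : [pchar k] =i pred0)
    (smooth_R : local_ring_of_smooth_variety iota R)
    (graded_a : graded_sequence_of_nonzero_ideals R a)
    (def_b : forall m : nat, (0 < m)%N ->
       is_asymptotic_multiplier_ideal iota R m%:R a (b m))
    (def_lca : forall m : nat, (0 < m)%N -> is_lc iota R (a m) (lca m))
    (def_lcb : forall m : nat, (0 < m)%N -> is_lc iota R (b m) (lcb m)) :
  let u := fun m : nat => (m%:R%:E * lca m)%E in
  let v := fun m : nat => (m%:R%:E * lcb m)%E in
  [/\ cvgn u, cvgn v & limn u = limn v].
Proof.
have [mR [d [x rR]]] := smooth_regular smooth_R.
move=> u v; have [l [ul vl]] := graded_limit char_k mR rR graded_a def_b def_lca def_lcb.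
split; [exact: cvgP ul|exact: cvgP vl|].
by rewrite (cvg_lim _ ul) // (cvg_lim _ vl).
Qed.
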